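(* Consider the functional data model $Y_{i,\boldsymbol j}=\mu(\boldsymbol x_{\boldsymbol j})+Z_i(\boldsymbol x_{\boldsymbol j})+\varepsilon_{i,\boldsymbol j}$, $i=1,\dots,n$, $\boldsymbol 1\le\boldsymbol j\le\boldsymbol p$, described in the context, and assume that the errors $\varepsilon_{i,\boldsymbol j}$ are independent and normally distributed $\mathcal N(0,\sigma_0^2)$ with $\sigma_0^2>0$. Let $\alpha,\beta,L,C_Z>0$ and let $\boldsymbol s\in\mathbb N_0^d$ satisfy $|\boldsymbol s|\le\lfloor\alpha\rfloor$. The infima below are over all estimators based on the observations, and in each part $c>0$ denotes some constant. (i) If the design satisfies the design density assumption stated in the context, and all coordinates of $\boldsymbol p$ are of the same order, that is $\boldsymbol p_{\min}\simeq\boldsymbol p_{\max}$, then $$\liminf_{n,\boldsymbol p\to\infty}\ \inf_{\hat\mu^{(\boldsymbol s)}_{n,\boldsymbol p}}\ \sup_{\mu\in\mathcal H(\alpha,L),\,Z\in\mathcal P(\beta,C_Z)}\mathbb E_{\mu,Z}\Big[\boldsymbol p_{\min}^{\alpha-|\boldsymbol s|}\,\big\|\hat\mu^{(\boldsymbol s)}_{n,\boldsymbol p}-\partial^{\boldsymbol s}\mu\big\|_\infty\Big]\ge c>0.$$ (ii) Setting $a_{n,\boldsymbol p}=\max\Big(\Big(\frac{\log(n\boldsymbol p^{\boldsymbol 1})}{n\,\boldsymbol p^{\boldsymbol 1}}\Big)^{\frac{\alpha-|\boldsymbol s|}{2\alpha+d}},\,n^{-1/2}\Big)$, we have $$\liminf_{n,\boldsymbol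 p\to\infty}\ \inf_{\hat\mu^{(\boldsymbol s)}_{n,\boldsymbol p}}\ \sup_{\mu\in\mathcal H(\alpha,L),\,Z\in\mathcal P(\beta,C_Z)}\mathbb E_{\mu,Z}\Big[a_{n,\boldsymbol p}^{-1}\,\big\|\hat\mu^{(\boldsymbol s)}_{n,\boldsymbol p}-\partial^{\boldsymbol s}\mu\big\|_\infty\Big]\ge c>0.$$ (iii) If $\beta<|\boldsymbol s|$, then for each $\beta_1$ with $\beta<\beta_1<\alpha$ we have $$\liminf_{n,\boldsymbol p\to\infty}\ \max_{|\boldsymbol k|=|\boldsymbol s|}\ \inf_{\hat\mu^{(\boldsymbol k)}_{n,\boldsymbol p}}\ \sup_{\mu\in\mathcal H(\alpha,L),\,Z\in\mathcal P(\beta,C_Z)}\mathbb E_{\mu,Z}\Big[n^{\frac{\alpha-|\boldsymbol s|}{2(\alpha-\beta_1)}}\,\big\|\hat\mu^{(\boldsymbol k)}_{n,\boldsymbol p}-\partial^{\boldsymbol k}\mu\big\|_\infty\Big]\ge c>0,$$ where the maximum is over $\boldsymbol k\in\mathbb N_0^d$ with $|\boldsymbol k|=|\boldsymbol s|$.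
   Context: Notation. $d\in\mathbb N$; $|\boldsymbol a|=\sum_r a_r$, $\boldsymbol 1=(1,\dots,1)$, $\boldsymbol a\le\boldsymbol b$ is componentwise, $\partial^{\boldsymbol s}=\partial_1^{s_1}\cdots\partial_d^{s_d}$. $\boldsymbol p=\boldsymbol p(n)=(p_1,\dots,p_d)$, $\boldsymbol p_{\min}=\min_r p_r$, $\boldsymbol p_{\max}=\max_r p_r$, $\boldsymbol p^{\boldsymbol 1}=\prod_r p_r$. $n,\boldsymbol p\to\infty$ means $n\to\infty$ and $\boldsymbol p_{\min}\to\infty$; $\simeq$ means of the same order (ratio bounded above and away from zero). $\|\cdot\|_\infty$ is the sup-norm on $[0,1]^d$ for functions and the maximum norm for vectors. $\lfloor\alpha\rfloor=\max\{k\in\mathbb N_0: k<\alpha\}$ (strict inequality). Hölder class. $\|f\|_{\mathcal H,\alpha}=\max_{|\boldsymbol k|\le\lfloor\alpha\rfloor}\sup_{\boldsymbol x}|\partial^{\boldsymbol k}f(\boldsymbol x)|+\max_{|\boldsymbol k|=\lfloor\alpha\rfloor}\sup_{\boldsymbol x\ne\boldsymbol y}\frac{|\partial^{\boldsymbol k}f(\boldsymbol x)-\partial^{\boldsymbol k}f(\boldsymbol y)|}{\|\boldsymbol x-\boldsymbol y\|_\infty^{\alpha-\lfloor\alpha\rfloor}}$, with $\boldsymbol x,\boldsymbol y\in[0,1]^d$; $\mathcal H(\alpha,L)$ is the set of $f\in C^{\lfloor\alpha\rfloor}([0,1]^d)$ (derivatives up to order $\lfloor\alpha\rfloor$ in the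 interior, continuously extendable to $[0,1]^d$) with $\|f\|_{\mathcal H,\alpha}\le L$. Process class. $\mathcal P(\beta,C_Z)$ is the class of processes $Z$ on $[0,1]^d$ with paths differentiable up to order $\lfloor\beta\rfloor$ for which there is a random variable $M$ with $\|Z\|_{\mathcal H,\beta}\le M$ a.s. and $\mathbb E[M^2]\le C_Z$. Model. $Y_{i,\boldsymbol j}=\mu(\boldsymbol x_{\boldsymbol j})+Z_i(\boldsymbol x_{\boldsymbol j})+\varepsilon_{i,\boldsymbol j}$, where $\mu$ is deterministic, $Z_1,\dots,Z_n$ are i.i.d. copies of a centered process $Z$ with continuous paths, and the errors $\varepsilon_{i,\boldsymbol j}$ are independent, centered, and independent of the $Z_i$. The fixed known design points $\boldsymbol x_{\boldsymbol j}=(x_{1,j_1},\dots,x_{d,j_d})\in[0,1]^d$, $1\le j_k\le p_k$, have Cartesian product structure with $x_{k,l}<x_{k,l+1}$, and may depend on $n$. Design density assumption. There exist Lipschitz continuous densities $f_k:[0,1]\to\mathbb R$, $1\le k\le d$, with $0<f_{k,\min}\le f_k(t)\le f_{k,\max}<\infty$ for $t\in[0,1]$, such that the design points satisfy $\int_0^{x_{k,l}}f_k(t)\,dt=\frac{l-0.5}{p_k}$, $l=1,\dots,p_k$, $k=1,\dots,d$. *)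

(* Defs.v *)
From HB Require Import structures.
From mathcomp Require Import all_boot all_order all_algebra.
From mathcomp Require Import all_classical all_reals all_analysis.

Set Implicit Arguments.
Unset Strict Implicit.
Unset Printing Implicit Defensive.

Import Order.TTheory GRing.Theory Num.Theory.
Import numFieldNormedType.Exports.

Local Open Scope classical_set_scope.
Local Open Scope ring_scope.

Definition msize (d : nat) (s : 'I_d -> nat) : nat := (\sum_(k < d) s k)%N.

(* The maximum of the natural numbers k < a (strict inequality, so that
   strict_floor 1 = 0); any such k is at most truncn a.  Used for a > 0. *)
Definition strict_floor (R : realType) (a : R) : nat :=
  (\max_(k < (Num.truncn a).+1 | ((k : nat)%:R < a)%R) k)%N.

Definition pmax (d : nat) (p : 'I_d -> nat) : nat := (\max_(k < d) p k)%N.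

(* For 0 < d the unit pmax p does not affect the minimum. *)
Definition pmin (d : nat) (p : 'I_d -> nat) : nat :=
  \big[minn/pmax p]_(k < d) p k.

Definition pprod (d : nat) (p : 'I_d -> nat) : nat := (\prod_(k < d) p k)%N.

(* A function on [0,1]^d is represented by a total function on 'rV[R]_d of
   which only the values on [cube] matter.  The library norm on 'rV[R]_d is the
   maximum norm. *)
Definition cube (R : realType) (d : nat) : set 'rV[R]_d :=
  [set x | forall k, 0 <= x 0 k <= 1].
Arguments cube R d : clear implicits.

Definition partial (R : realType) (d : nat) (k : 'I_d) (f : 'rV[R]_d -> R) :
  'rV[R]_d -> R := 'D_(delta_mx 0 k) f.

(* Iterated partial derivatives along a word of coordinate directions, the
   leftmost letter being differentiated last. *)
Definition wpartial (R : realType) (d : nat) (w : seq 'I_d)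
  (f : 'rV[R]_d -> R) : 'rV[R]_d -> R := foldr (@partial R d) f w.

Definition mword (d : nat) (s : 'I_d -> nat) : seq 'I_d :=
  flatten [seq nseq (s k) k | k <- enum 'I_d].

(* The derivative of multi-index s, computed in the interior of the cube and
   extended by continuity to the boundary. *)
Definition mderiv (R : realType) (d : nat) (s : 'I_d -> nat)
  (f : 'rV[R]_d -> R) (x : 'rV[R]_d) : R :=
  lim (wpartial (mword s) f @ within (cube R d)° (nbhs x)).

(* C^m([0,1]^d): all partial derivatives up to order m exist in the interior
   and extend continuously to the closed cube. *)
Definition Cm_cube (R : realType) (d m : nat) (f : 'rV[R]_d -> R) : Prop :=
  [/\ {within cube R d, continuous f},
      forall (w : seq 'I_d) (k : 'I_d) (x : 'rV[R]_d), (size w < m)%N ->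
        (cube R d)° x -> derivable (wpartial w f) x (delta_mx 0 k)
    & forall w : seq 'I_d, (size w <= m)%N ->
        exists2 g : 'rV[R]_d -> R, {within cube R d, continuous g} &
          forall x, (cube R d)° x -> g x = wpartial w f x].

Definition sup_norm (R : realType) (d : nat) (f : 'rV[R]_d -> R) : \bar R :=
  ereal_sup [set (`|f x|)%:E | x in cube R d].

(* Suprema over the finite sets of multi-indices are the maxima. *)
Definition holder_norm (R : realType) (d : nat) (a : R) (f : 'rV[R]_d -> R) :
  \bar R :=
  (ereal_sup [set sup_norm (mderiv k f) |
     k in [set k : 'I_d -> nat | (msize k <= strict_floor a)%N]]
   + ereal_sup [set ereal_sup
       [set (`|mderiv k f z.1 - mderiv k f z.2| /
             `|z.1 - z.2| `^ (a - (strict_floor a)%:R))%:E |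
        z in [set z : 'rV[R]_d * 'rV[R]_d |
              [/\ cube R d z.1, cube R d z.2 & z.1 != z.2]]] |
     k in [set k : 'I_d -> nat | msize k = strict_floor a]])%E.

Definition holder_class (R : realType) (d : nat) (a L : R) :
  set ('rV[R]_d -> R) :=
  [set f | Cm_cube (strict_floor a) f /\ (holder_norm a f <= L%:E)%E].

(* The sigma-algebra on T -> R generated by the evaluations at points of D. *)
Definition cylinder_sigma (R : realType) (T : Type) (D : set T) :
  set_system (T -> R) :=
  <<s [set A | exists2 t, D t & exists2 B : set R, measurable B &
         A = (fun f : T -> R => f t) @^-1` B] >>.

Definition is_process (R : realType) (d : nat) (dd : measure_display)
  (Omega : measurableType dd) (Z : Omega -> 'rV[R]_d -> R) : Prop :=
  forall x, cube R d x -> measurable_fun [set: Omega] (fun w => Z w x).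

Definition continuous_paths (R : realType) (d : nat) (dd : measure_display)
  (Omega : measurableType dd) (Z : Omega -> 'rV[R]_d -> R) : Prop :=
  forall w, {within cube R d, continuous (Z w)}.

Definition centered (R : realType) (d : nat) (dd : measure_display)
  (Omega : measurableType dd) (P : probability Omega R)
  (Z : Omega -> 'rV[R]_d -> R) : Prop :=
  forall x, cube R d x ->
    P.-integrable [set: Omega] (fun w => (Z w x)%:E) /\
    (\int[P]_w (Z w x)%:E = 0)%E.

Definition process_class (R : realType) (d : nat) (b CZ : R)
  (dd : measure_display) (Omega : measurableType dd)
  (P : probability Omega R) (Z : Omega -> 'rV[R]_d -> R) : Prop :=
  [/\ is_process Z,
      forall w, Cm_cube (strict_floor b) (Z w)
    & exists M : {RV P >-> R},
        {ae P, forall w, (holder_norm b (Z w) <= (M w)%:E)%E} /\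
        ('E_P[fun w => (M w ^+ 2)%R] <= CZ%:E)%E].

(* Mutual independence of a finite family of sigma-algebras; since each F i
   contains the whole space, the product rule over all of I yields the product
   rule over all subfamilies. *)
Definition independent_families (R : realType) (dd : measure_display)
  (Omega : measurableType dd) (P : probability Omega R) (I : finType)
  (F : I -> set_system Omega) : Prop :=
  forall E : I -> set Omega, (forall i, F i (E i)) ->
    P (\bigcap_(i in [set: I]) E i) = (\prod_(i : I) P (E i))%E.

(* The multi-indices j with 1 <= j <= p, counted from 0 in each coordinate. *)
Definition grid (d : nat) (p : 'I_d -> nat) : finType :=
  {dffun forall k : 'I_d, 'I_(p k)}.

Definition design_point (R : realType) (d : nat) (p : 'I_d -> nat)
  (x : forall k : 'I_d, 'I_(p k) -> R) (j : grid p) : 'rV[R]_d :=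
  \row_k x k (j k).

Definition is_design (R : realType) (d : nat) (p : 'I_d -> nat)
  (x : forall k : 'I_d, 'I_(p k) -> R) : Prop :=
  (forall k l, 0 <= x k l <= 1) /\
  (forall k (l l' : 'I_(p k)), (l < l')%N -> x k l < x k l').

Definition design_densities (R : realType) (d : nat) (f : 'I_d -> R -> R) :
  Prop :=
  forall k,
    [/\ [lipschitz f k t | t in `[0, 1]],
        exists lo hi : R, 0 < lo /\ forall t, 0 <= t <= 1 -> lo <= f k t <= hi
      & (\int[lebesgue_measure]_(t in `[0%R, 1%R]) (f k t)%:E
         = 1)%E].

(* With l counted from 0, the quantile level (l - 0.5) / p_k reads
   (l + 1/2) / p_k. *)
Definition density_design (R : realType) (d : nat) (f : 'I_d -> R -> R)
  (p : 'I_d -> nat) (x : forall k : 'I_d, 'I_(p k) -> R) : Prop :=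
  forall k (l : 'I_(p k)),
    (\int[lebesgue_measure]_(t in `[0%R, x k l]) (f k t)%:E
     = ((l%:R + 2^-1) / (p k)%:R)%:E)%E.

Definition obs_index (d n : nat) (p : 'I_d -> nat) : finType :=
  ('I_n * grid p)%type.

(* The sigma-algebras generated by the processes Z_1, ..., Z_n and by the
   single errors. *)
Definition source_sigma (R : realType) (d n : nat) (p : 'I_d -> nat)
  (dd : measure_display) (Omega : measurableType dd)
  (Zs : 'I_n -> Omega -> 'rV[R]_d -> R)
  (eps : obs_index n p -> Omega -> R) (a : 'I_n + obs_index n p) :
  set_system Omega :=
  match a with
  | inl i => [set Zs i @^-1` A | A in cylinder_sigma (cube R d)]
  | inr q => [set eps q @^-1` B | B in [set B : set R | measurable B]]
  end.

(* Z_1, ..., Z_n are independent copies (under P) of the process Z (under P0),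
   and the errors are independent N(0, sigma0^2) variables, independent of
   Z_1, ..., Z_n.  The second parameter of normal_prob is the standard
   deviation. *)
Definition fd_sources (R : realType) (d n : nat) (p : 'I_d -> nat) (sigma0 : R)
  (dd0 : measure_display) (Omega0 : measurableType dd0)
  (P0 : probability Omega0 R) (Z : Omega0 -> 'rV[R]_d -> R)
  (dd : measure_display) (Omega : measurableType dd) (P : probability Omega R)
  (Zs : 'I_n -> Omega -> 'rV[R]_d -> R)
  (eps : obs_index n p -> {RV P >-> R}) : Prop :=
  [/\ forall i, is_process (Zs i) /\ continuous_paths (Zs i),
      forall i A, cylinder_sigma (cube R d) A ->
        P (Zs i @^-1` A) = P0 (Z @^-1` A),
      forall q (B : set R), measurable B ->
        P (eps q @^-1` B) = normal_prob 0 sigma0 B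
    & independent_families P (source_sigma Zs (fun q => eps q : Omega -> R))].

Definition fd_obs (R : realType) (d n : nat) (p : 'I_d -> nat)
  (x : forall k : 'I_d, 'I_(p k) -> R) (mu : 'rV[R]_d -> R)
  (Omega : Type) (Zs : 'I_n -> Omega -> 'rV[R]_d -> R)
  (eps : obs_index n p -> Omega -> R) (w : Omega) : obs_index n p -> R :=
  fun q => mu (design_point x q.2) + Zs q.1 w (design_point x q.2) + eps q w.

(* Estimators map the observations to functions on the cube, every value of
   which is a measurable function of the observations. *)
Definition estimator (R : realType) (d n : nat) (p : 'I_d -> nat) :
  set ((obs_index n p -> R) -> 'rV[R]_d -> R) :=
  [set T | forall x, cube R d x -> forall B : set R, measurable B ->
     cylinder_sigma [set: obs_index n p] ((fun y => T y x) @^-1` B)].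
Arguments estimator R {d} n p.

(* The values E_{mu,Z}[rate * ||T - d^s mu||_oo] of the normalised risk of T,
   over all mu and Z in the two classes.  The joint law of the observations is
   determined by mu and the law of Z, so the expectation may be computed in any
   realisation of the model.  The loss is a supremum over uncountably many
   points and need not be measurable; the library integral of a nonnegative
   function is then its lower integral. *)
Definition risks (R : realType) (d : nat) (alpha beta L CZ sigma0 : R)
  (n : nat) (p : 'I_d -> nat) (x : forall k : 'I_d, 'I_(p k) -> R)
  (s : 'I_d -> nat) (rate : R)
  (T : (obs_index n p -> R) -> 'rV[R]_d -> R) : set (\bar R) :=
  [set r | exists2 mu : 'rV[R]_d -> R, holder_class alpha L mu &
    exists (dd0 : measure_display) (Omega0 : measurableType dd0)
      (P0 : probability Omega0 R) (Z : Omega0 -> 'rV[R]_d -> R),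
    [/\ process_class beta CZ P0 Z, centered P0 Z, continuous_paths Z &
    exists (dd : measure_display) (Omega : measurableType dd)
      (P : probability Omega R) (Zs : 'I_n -> Omega -> 'rV[R]_d -> R)
      (eps : obs_index n p -> {RV P >-> R}),
      fd_sources sigma0 P0 Z Zs eps /\
      r = (\int[P]_w (rate%:E *
             sup_norm (fun t => (T (fd_obs x mu Zs (fun q => eps q) w) t
                                - mderiv s mu t)%R)))%E]].

Definition minimax_risk (R : realType) (d : nat) (alpha beta L CZ sigma0 : R)
  (n : nat) (p : 'I_d -> nat) (x : forall k : 'I_d, 'I_(p k) -> R)
  (s : 'I_d -> nat) (rate : R) : \bar R :=
  ereal_inf [set ereal_sup (risks alpha beta L CZ sigma0 x s rate T) |
             T in estimator R n p].

Definition a_rate (R : realType) (d : nat) (alpha : R) (n : nat)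
  (p : 'I_d -> nat) (s : 'I_d -> nat) : R :=
  let N : R := n%:R * (pprod p)%:R in
  Num.max ((ln N / N) `^ ((alpha - (msize s)%:R) / (2 * alpha + d%:R)))
          (n%:R `^ (- 2^-1)).

(* Main.v *)
Require Import Defs.
From HB Require Import structures.
From mathcomp Require Import all_boot all_order all_algebra.
From mathcomp Require Import all_classical all_reals all_analysis.
From mathcomp Require Import measurable_realfun.
From mathcomp Require Import ring lra zify.

Set Implicit Arguments.
Unset Strict Implicit.
Unset Printing Implicit Defensive.

Import Order.TTheory GRing.Theory Num.Theory.
Import numFieldNormedType.Exports.

Local Open Scope classical_set_scope.
Local Open Scope ring_scope.

(** Each lower bound comes from mean functions whose observations have nearly
    the same law although their [s]-th derivatives differ by an amount [delta]
    at some point; [minimax_ge] turns such a family into a risk bound of order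
    [delta].  The parts of the theorem differ in what hides the signal.

    All hypotheses live on one probability space with i.i.d. N(0, sigma0^2)
    variables: X_i for each curve and X_ij for each observation.  For a fixed
    function g, the observations are X_i g(x_j) + X_ij under every hypothesis,
    and the hypotheses differ only by a change of measure, which shifts the mean
    of X_i to theta and that of X_ij to e_ij.  Then Z_i = (X_i - theta) g and
    eps_ij = X_ij - e_ij have the prescribed laws, and the mean function may be
    any mu with mu(x_j) = theta g(x_j) + e_ij ([risk_of_shift]).  The likelihood
    ratios are products of Gaussian ones, so that the expectation of L_m L_m' is
    exp(<m, m'> / sigma0^2) ([integral_product_lrM]).  The zero mean is tested
    against the uniform mixture of finitely many other hypotheses; if the second
    moment of the mixture is at most 5/4, the errors of first and second kind of
    any test sum up to at least 1/2 ([mixture_testing]).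

    The means are bumps A psi((x_1 - a_1) / h) ... psi((x_d - a_d) / h), where
    psi(t) = (t (t - 1))^r on [0, 1] and 0 elsewhere.  Such a bump has Hoelder
    norm of order A h^(- alpha), and its derivative of order s has size
    A h^(- |s|) at one known point ([bump_system_exists]).

    Discretisation, part (i).  Among pmin + 1 equal subintervals of [0, 1], one
    contains no design coordinate in the direction with pmin coordinates.  A
    bump of width h = 1 / (pmin + 1) and height of order h^alpha supported over
    this interval vanishes at all design points ([between_points_bound]).

    Process, parts (ii) and (iii).  Let g be a bump of width h and let
    mu = theta g with theta of order n^(-1/2): detecting mu amounts to detecting
    the shift theta in n Gaussian variables ([mean_shift_bound]).  With h = 1
    this yields the rate n^(-1/2).  For small h the bump g may have height
    h^beta1, since its Hoelder norm of exponent beta < beta1 stays bounded; if h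
    is chosen such that h^(alpha - beta1) = n^(-1/2), then mu has height of order
    h^alpha, as the smoothness class allows ([rough_process_bound]).

    Errors, part (ii).  Let N be n times the number of design points and cut the
    cube into m^d cells of side h = 1 / m.  At least half of them contain at most
    twice the average number of design points ([many_light_cells]).  A bump of
    height c h^alpha in one of these cells carries information of order
    c^2 N h^(2 alpha + d).  For h^(2 alpha + d) of order log N / N this is a
    small multiple of log N, and hence smaller than the logarithm of the number
    of cells: the place of the bump cannot be found ([light_cells_bound],
    [nonparametric_bound]). *)

(** * A bump on the line *)

Definition bump_poly (R : realType) (r : nat) : {poly R} :=
  ('X * ('X - 1%:P)) ^+ r.

(** The [j]-th derivative of the bump equal to [(t (t - 1)) ^ r] on [[0, 1]]
    and to zero elsewhere. A polynomial bump has only [r - 1] continuous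
    derivatives, which is enough in a Hoelder class of given exponent, and all
    of them are explicit. *)
Definition bump_deriv (R : realType) (r j : nat) (t : R) : R :=
  if 0 <= t <= 1 then ((bump_poly R r)^`(j)).[t] else 0.

Lemma bump_poly_deriv (R : realType) (r j : nat) : (j <= r)%N ->
  exists q : {poly R}, (bump_poly R r)^`(j) = ('X * ('X - 1%:P)) ^+ (r - j) * q.
Proof.
elim: j => [|j IH] jr.
  by exists 1; rewrite subn0 mulr1.
have [q Eq] := IH (ltnW jr).
rewrite derivnS Eq.
have -> : (r - j = (r - j.+1).+1)%N by rewrite subnSK.
rewrite derivM deriv_exp /=.
set u : {poly R} := 'X * ('X - 1%:P).
exists ((u^`() *+ (r - j.+1).+1) * q + u * q^`()).
rewrite mulrDr mulrA exprSr -!mulrA; congr (_ + _).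
by rewrite !mulrnAl !mulrnAr !mulrA [u^`() * _]mulrC.
Qed.

Lemma bump_poly_deriv_end (R : realType) (r j : nat) (a : R) : (j < r)%N ->
  (a == 0) || (a == 1) -> ((bump_poly R r)^`(j)).[a] = 0.
Proof.
move=> jr a01; have [q ->] := bump_poly_deriv R (ltnW jr).
rewrite hornerM horner_exp !hornerE.
have -> : a * (a - 1) = 0.
  by case/orP: a01 => /eqP ->; rewrite ?mul0r ?subrr ?mulr0.
by rewrite expr0n subn_eq0 leqNgt jr mul0r.
Qed.

(** The bump is dominated by a polynomial with double roots at the endpoints of
    its support; comparison gives the derivative there, where the two formulas
    for the bump meet. *)
Lemma is_derive0_le (R : realType) (F G : R -> R) (a : R) :
  (forall t, `|F t| <= `|G t|) -> G a = 0 -> is_derive a 1 G 0 ->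
  is_derive a 1 F 0.
Proof.
move=> FG Ga dG.
have Fa : F a = 0 by apply/eqP; rewrite -normr_le0 (le_trans (FG a)) // Ga normr0.
have /cvgrPdist_lt cG : (fun h : R => h^-1 *: (G (h *: (1:R) + a) - G a)) @ 0^' --> (0:R).
  have H : (fun h : R => h^-1 *: (G (h *: (1:R) + a) - G a)) @ 0^' --> 'D_1 G a.
    exact: (@ex_derive _ _ _ _ _ _ _ dG).
  by rewrite derive_val in H.
have cF : (fun h : R => h^-1 *: (F (h *: (1:R) + a) - F a)) @ 0^' --> (0:R).
  apply/cvgrPdist_lt => e e0; near=> h.
  have : `|0 - h^-1 *: (G (h *: 1 + a) - G a)| < e by near: h; exact: cG.
  rewrite !sub0r !normrN Ga Fa !subr0 !normrZ; apply: le_lt_trans.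
  by rewrite ler_wpM2l.
apply: DeriveDef; first by apply/cvg_ex; exists 0.
exact/cvg_lim.
Unshelve. all: by end_near. Qed.

Lemma is_derive_bump (R : realType) (r j : nat) (t : R) : (j.+1 < r)%N ->
  is_derive t 1 (bump_deriv r j) (bump_deriv r j.+1 t).
Proof.
move=> jr; pose p := (bump_poly R r)^`(j).
have dp : is_derive t 1 (horner p) ((bump_poly R r)^`(j.+1)).[t].
  by rewrite derivnS; exact: is_derive_poly.
have bump_near (a b : R) : a < t < b ->
    (forall z, a < z < b -> bump_deriv r j z = p.[z]) ->
    is_derive t 1 (bump_deriv r j) ((bump_poly R r)^`(j.+1)).[t].
  move=> tab E; apply: near_eq_is_derive dp => //.
  have := @near_in_itvoo R a b t; rewrite in_itv/= => /(_ tab).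
  by apply: filterS => z; rewrite in_itv /= => /E ->.
(* at 0 and 1 the polynomial vanishes together with its derivative *)
have [t01|] := boolP ((t == 0) || (t == 1)).
  have -> : bump_deriv r j.+1 t = 0.
    by rewrite /bump_deriv bump_poly_deriv_end// if_same.
  apply: (@is_derive0_le R _ (horner p)).
  - by move=> z; rewrite /bump_deriv; case: ifP => // _; rewrite normr0.
  - exact: bump_poly_deriv_end (ltnW jr) t01.
  - by have := dp; rewrite bump_poly_deriv_end.
rewrite negb_or => /andP[t0 t1].
have [tlt|tge] := ltP t 0.
  have -> : bump_deriv r j.+1 t = 0 by rewrite /bump_deriv leNgt tlt.
  apply: (@near_eq_is_derive _ _ _ (cst 0)).
  near=> z; rewrite /bump_deriv leNgt.
  suff -> : z < 0 by [].
  by near: z; exact: lt_nbhsl.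
have [tgt|tle] := ltP 1 t.
  have -> : bump_deriv r j.+1 t = 0 by rewrite /bump_deriv [t <= 1]leNgt tgt andbF.
  apply: (@near_eq_is_derive _ _ _ (cst 0)).
  near=> z; rewrite /bump_deriv [z <= 1]leNgt.
  suff -> : 1 < z by rewrite andbF.
  by near: z; exact: lt_nbhsr.
rewrite {2}/bump_deriv tge tle /=.
apply: (@bump_near 0 1); first by rewrite !lt_neqAle eq_sym t0 t1 tge tle.
by move=> z /andP[z0 z1]; rewrite /bump_deriv !ltW.
Unshelve. all: by end_near. Qed.

Lemma bump_bounded (R : realType) (r j : nat) :
  exists C : R, forall t, `|bump_deriv r j t| <= C.
Proof.
pose p := (bump_poly R r)^`(j).
exists (\sum_(i < size p) `|p`_i|) => t; rewrite /bump_deriv.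
case: ifP => [/andP[t0 t1]|_]; last by rewrite normr0 sumr_ge0.
rewrite -/p horner_coef (le_trans (ler_norm_sum _ _ _)) // ler_sum // => i _.
rewrite normrM ler_piMr // normrX ger0_norm // exprn_ile1 //.
Qed.

Lemma bump_lipschitz (R : realType) (r j : nat) : (j.+1 < r)%N ->
  exists C : R, forall t u, `|bump_deriv r j t - bump_deriv r j u| <= C * `|t - u|.
Proof.
move=> jr; have [C HC] := bump_bounded R r j.+1; exists C => t u.
wlog ut : t u / u <= t.
  move=> H; have [/H//|/ltW /H] := leP u t.
  by rewrite distrC [`|u - t|]distrC.
have [|c _ ->] := MVT_segment ut (fun x _ => is_derive_bump x jr).
  apply: continuous_subspaceT => x.
  apply: differentiable_continuous; apply/derivable1_diffP.
  by case: (is_derive_bump x jr).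
by rewrite normrM ler_wpM2r.
Qed.

(** The derivative polynomial is nonzero and has finitely many roots, so some
    point of a fine enough grid of [[0, 1]] is not a root. *)
Lemma bump_nonzero (R : realType) (r j : nat) : (j <= r)%N ->
  exists2 t : R, 0 < t < 1 & bump_deriv r j t != 0.
Proof.
move=> jr; pose p := (bump_poly R r)^`(j).
have mp : bump_poly R r \is monic.
  by rewrite monic_exp // monicMl ?monicX // monicXsubC.
have szp : (size (bump_poly R r)).-1 = (2 * r)%N.
  by rewrite size_exp size_mul ?polyX_eq0 ?polyXsubC_eq0 // size_polyX size_XsubC.
have p0 : p != 0.
  apply/eqP => /(congr1 (fun q : {poly R} => q`_(2 * r - j)%N)).
  rewrite coef_derivn coef0 addnC subnK; last by lia.
  rewrite -szp -/(lead_coef _) (monicP mp) => /eqP.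
  by rewrite pnatr_eq0 eqn0Ngt ffact_gt0 szp => /negP; apply; lia.
apply: contrapT => H.
pose s : seq R := [seq (i.+1%:R / (size p).+2%:R) | i <- iota 0 (size p).+1].
suff: (size s < size p)%N by rewrite size_map size_iota ltnNge leqnSn.
have N0 : (0 : R) < (size p).+2%:R by rewrite ltr0n.
apply: (max_poly_roots p0).
- apply/allP => y /mapP[i]; rewrite mem_iota add0n => /andP[_ im] Ey; rewrite {y}Ey.
  set t := _ / _.
  have t0 : 0 < t by rewrite divr_gt0 ?ltr0n.
  have t1 : t < 1 by rewrite ltr_pdivrMr // mul1r ltr_nat ltnS.
  apply/negPn/negP => pt; apply: H; exists t; rewrite ?t0 ?t1 //.
  by rewrite /bump_deriv !ltW.
- rewrite map_inj_uniq ?iota_uniq // => i k.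
  by move/(mulIf (invr_neq0 (lt0r_neq0 N0)))/eqP; rewrite eqr_nat => /eqP [].
Qed.

(** * Products of bumps and their Hoelder norms *)

Lemma strict_floor_lt (R : realType) (a : R) : 0 < a -> (strict_floor a)%:R < a.
Proof.
move=> a0; rewrite /strict_floor.
by elim/big_ind: _ => // x y xa ya; rewrite /maxn; case: ifP.
Qed.

(** Together with [strict_floor_lt] this puts the Hoelder exponent of the
    highest derivatives into [(0, 1]], including the case of an integer [a]. *)
Lemma le_strict_floorS (R : realType) (a : R) : 0 < a ->
  a <= (strict_floor a).+1%:R.
Proof.
move=> a0.
have /andP[ta at1] := truncn_itv (ltW a0).
have le_floor (k : nat) : (k < (Num.truncn a).+1)%N -> k%:R < a -> (k <= strict_floor a)%N.
  move=> kt ka.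
  exact: (@leq_bigmax_cond _ (fun i : 'I__ => (i : nat)%:R < a)
    (fun i => i) (Ordinal kt)).
move: ta; rewrite le_eqVlt => /predU1P[E|ta]; last first.
  by rewrite (le_trans (ltW at1)) // ler_nat ltnS le_floor.
case Et : (Num.truncn a) => [|t]; first by move: a0; rewrite -E Et ltxx.
rewrite -[X in X <= _]E Et ler_nat ltnS le_floor ?Et ?ltnS //.
by rewrite -E Et ltr_nat.
Qed.

Lemma prod_bounded (R : realType) (I : Type) (s : seq I) (a : I -> R) (C : R) :
  0 <= C -> (forall i, `|a i| <= C) -> `|\prod_(i <- s) a i| <= C ^+ size s.
Proof.
move=> C0 aC; elim: s => [|i s IH]; first by rewrite big_nil normr1.
by rewrite big_cons normrM exprS ler_pM.
Qed.

Lemma prod_lipschitz (R : realType) (I : Type) (s : seq I) (a b : I -> R)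
    (C e : R) : 0 <= C -> (forall i, `|a i| <= C) -> (forall i, `|b i| <= C) ->
  (forall i, `|a i - b i| <= C * e) ->
  `|\prod_(i <- s) a i - \prod_(i <- s) b i| <= (size s)%:R * C ^+ size s * e.
Proof.
move=> C0 aC bC abC; elim: s => [|i s IH].
  by rewrite !big_nil subrr normr0 !mul0r.
rewrite !big_cons.
have -> : a i * \prod_(j <- s) a j - b i * \prod_(j <- s) b j =
  a i * (\prod_(j <- s) a j - \prod_(j <- s) b j) + (a i - b i) * \prod_(j <- s) b j by ring.
apply: (le_trans (ler_normD _ _)); rewrite !normrM /=.
have -> : (size s).+1%:R * C ^+ (size s).+1 * e =
  C * ((size s)%:R * C ^+ size s * e) + C * e * C ^+ size s.
  by rewrite exprS -natr1; ring.
apply: lerD; first by rewrite ler_pM.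
by apply: ler_pM => //; exact: prod_bounded.
Qed.

(** The partial derivatives of order [c] of a product of bumps of height [A],
    width [h] and lower corner [a]. Keeping the multi-index [c] as a parameter
    makes the family closed under partial derivatives. *)
Definition prod_bump (R : realType) (d r : nat) (A h : R) (a : 'I_d -> R)
  (c : 'I_d -> nat) (x : 'rV[R]_d) : R :=
  A * \prod_k (h^-1 ^+ c k * bump_deriv r (c k) ((x 0 k - a k) / h)).

(** Reduces a directional derivative to a derivative on the line, where the
    chain rule for real functions applies. *)
Lemma is_derive_line (R : realType) (d : nat) (f : 'rV[R]_d -> R)
    (x v : 'rV[R]_d) (df : R) :
  is_derive (0 : R) 1 (fun t => f (t *: v + x)) df -> is_derive x v f df.
Proof.
move=> [D E].
have Eq : (fun h : R => h^-1 *: (f (h *: v + x) - f x)) =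
   (fun h : R => h^-1 *: (((fun t => f (t *: v + x)) \o shift 0) (h *: 1) -
     (fun t => f (t *: v + x)) 0)).
  apply/funext => h /=; rewrite scale0r add0r addr0.
  by rewrite /GRing.scale /= mulr1.
apply: DeriveDef; first by rewrite /derivable [X in X @ _]Eq.
by rewrite -E /derive [X in X @ _]Eq.
Qed.

Lemma is_derive_prod_bump (R : realType) (d r : nat) (A h : R) (a : 'I_d -> R)
    (c : 'I_d -> nat) (x : 'rV[R]_d) (k : 'I_d) :
  ((c k).+1 < r)%N ->
  is_derive x (delta_mx 0 k) (prod_bump r A h a c)
    (prod_bump r A h a (fun l => ((l == k) + c l)%N) x).
Proof.
move=> ckr; apply: is_derive_line.
pose K := A * \prod_(l | l != k) (h^-1 ^+ c l * bump_deriv r (c l) ((x 0 l - a l) / h)).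
have -> : (fun t => prod_bump r A h a c (t *: delta_mx 0 k + x)) =
   (K * h^-1 ^+ c k) \*: (bump_deriv r (c k) \o (fun t : R => h^-1 * (t + (x 0 k - a k)))).
  apply/funext => t; rewrite /prod_bump (bigD1 k) //=.
  rewrite -[RHS]/(K * h^-1 ^+ c k *
    bump_deriv r (c k) (h^-1 * (t + (x 0 k - a k)))) /K !mxE !eqxx mulr1.
  rewrite (_ : h^-1 * _ = (t + x 0 k - a k) / h); last by rewrite mulrC addrA.
  rewrite (eq_bigr (fun l => h^-1 ^+ c l * bump_deriv r (c l) ((x 0 l - a l) / h))).
    by ring.
  by move=> l lk; rewrite !mxE /= (negPf lk) mulr0 add0r.
have -> : prod_bump r A h a (fun l => ((l == k) + c l)%N) x =
  (K * h^-1 ^+ c k) *: (bump_deriv r (c k).+1 (h^-1 * (0 + (x 0 k - a k))) * h^-1).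
  rewrite /prod_bump (bigD1 k) //= eqxx add1n add0r [h^-1 * (_ - _)]mulrC.
  rewrite -[RHS]/(_ * _) /K exprS.
  have -> : \prod_(i < d | i != k) (h^-1 ^+ ((i == k) + c i) *
      bump_deriv r ((i == k) + c i) ((x 0 i - a i) / h)) = 
    \prod_(l < d | l != k) (h^-1 ^+ c l * bump_deriv r (c l) ((x 0 l - a l) / h)).
    by apply: eq_bigr => l lk; rewrite (negPf lk).
  by ring.
pose g (t : R) := h^-1 * (t + (x 0 k - a k)).
have dg : is_derive (0 : R) 1 g h^-1.
  have H := is_derive_shift 0 1 (x 0 k - a k).
  have := @is_deriveZ _ _ _ _ h^-1 _ _ _ H.
  by rewrite /GRing.scale /= mulr1.
have db := @is_derive_bump R r (c k) (g 0) ckr.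
exact: (@is_deriveZ _ _ _ _ _ _ _ _ (@is_derive1_comp _ _ _ _ _ _ db dg)).
Qed.

Lemma count_mword (d : nat) (s : 'I_d -> nat) (k : 'I_d) :
  count_mem k (mword s) = s k.
Proof.
rewrite /mword count_flatten -map_comp sumnE big_map big_enum /=.
rewrite (bigD1 k) //= count_nseq /= eqxx mul1n big1 ?addn0 // => l lk.
by rewrite count_nseq /= (negPf lk).
Qed.

Lemma size_mword (d : nat) (s : 'I_d -> nat) : size (mword s) = msize s.
Proof.
rewrite /mword size_flatten /shape -map_comp sumnE big_map big_enum.
by apply: eq_bigr => k _; rewrite /= size_nseq.
Qed.

Lemma wpartial_prod_bump (R : realType) (d r : nat) (A h : R) (a : 'I_d -> R)
    (w : seq 'I_d) : (size w < r)%N ->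
  wpartial w (prod_bump r A h a (fun=> 0%N)) =
  prod_bump r A h a (fun k => count_mem k w).
Proof.
elim: w => [//|k w IH] wr /=; rewrite IH; last exact: ltnW.
apply/funext => x; rewrite /partial.
have H := @is_derive_prod_bump R d r A h a (fun l => count_mem l w) x k.
rewrite (@derive_val _ _ _ _ _ _ _ (H _)) //.
- by congr (prod_bump _ _ _ _ _ _); apply/funext => l; rewrite eq_sym.
- by apply: leq_ltn_trans wr; rewrite ltnS count_size.
Qed.

Lemma interior_cube (R : realType) (d : nat) (x : 'rV[R]_d) :
  (forall k, 0 < x 0 k < 1) -> (cube R d)° x.
Proof.
move=> x01; rewrite /interior /=.
have H (k : 'I_d) : nbhs x [set y : 'rV[R]_d | 0 <= y 0 k <= 1].
  have /andP[x0 x1] := x01 k.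
  have c : (fun y : 'rV[R]_d => y 0 k) @ x --> x 0 k by exact: coord_continuous.
  near=> y; apply/andP; split; apply: ltW.
  - near: y; exact: (cvgr_gt _ c).
  - near: y; exact: (cvgr_lt _ c).
exact: (filter_forall _ H).
Unshelve. all: by end_near. Qed.

(** The derivatives at boundary points are limits from the interior; segments
    from a point of the cube to its centre show that these limits are along a
    proper filter. *)
Lemma within_cube_proper (R : realType) (d : nat) (x : 'rV[R]_d) :
  cube R d x -> ProperFilter (within (cube R d)° (nbhs x)).
Proof.
move=> cx; apply: Build_ProperFilter_ex => B.
rewrite /within /= => HB.
pose y (e : R) : 'rV[R]_d := x + e *: (const_mx (2^-1) - x).
have cy : y @ (0:R)^'+ --> x.
  rewrite -[X in _ --> X]addr0; apply: cvgD; first exact: cvg_cst.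
  rewrite -[X in _ --> X](scale0r (const_mx 2^-1 - x)).
  apply: cvgZl; exact: cvg_at_right_filter.
have Hn : \forall e \near (0:R)^'+, (cube R d)° (y e) -> B (y e) := cy _ HB.
near (0:R)^'+ => e.
exists (y e); apply: (near Hn e) => //; apply: interior_cube => k.
have e0 : 0 < e by [].
have e1 : e < 1 by near: e; exact: nbhs_right_lt.
rewrite /y !mxE; have /andP[] := cx k; nra.
Unshelve. all: by end_near. Qed.

Lemma bump_const (R : realType) (r : nat) : exists2 C : R, 1 <= C &
  forall j, (j.+1 < r)%N -> (forall t, `|bump_deriv r j t| <= C) /\
    forall t u, `|bump_deriv r j t - bump_deriv r j u| <= C * `|t - u|.
Proof.
have /choice[B HB] : forall j, exists B : R, (j.+1 < r)%N ->
    (forall t, `|bump_deriv r j t| <= B) /\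
    forall t u, `|bump_deriv r j t - bump_deriv r j u| <= B * `|t - u|.
  move=> j; have [jr|_] := boolP (j.+1 < r)%N; last by exists 0.
  have [B1 H1] := bump_bounded R r j; have [B2 H2] := bump_lipschitz R jr.
  exists (Num.max B1 B2) => _; split=> [t|t u].
    by rewrite (le_trans (H1 t)) // le_max lexx.
  by rewrite (le_trans (H2 t u)) // ler_wpM2r // le_max lexx orbT.
exists (1 + \sum_(j < r) `|B j|); first by rewrite lerDl sumr_ge0.
move=> j jr; have [H1 H2] := HB j jr.
have BC : B j <= 1 + \sum_(j < r) `|B j|.
  rewrite (bigD1 (Ordinal (ltnW jr))) //= addrCA (le_trans (ler_norm _)) // lerDl.
  by rewrite addr_ge0 // sumr_ge0.
split=> [t|t u]; first exact: le_trans BC.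
by rewrite (le_trans (H2 t u)) // ler_wpM2r.
Qed.

Lemma prod_bumpE (R : realType) (d r : nat) (A h : R) (a : 'I_d -> R)
    (c : 'I_d -> nat) (x : 'rV[R]_d) :
  prod_bump r A h a c x =
  A * h^-1 ^+ msize c * \prod_k bump_deriv r (c k) ((x 0 k - a k) / h).
Proof. by rewrite /prod_bump big_split /= -mulrA /msize expr_sum. Qed.

Lemma norm_coord (R : realType) (d : nat) (x : 'rV[R]_d) (k : 'I_d) :
  `|x 0 k| <= `|x|.
Proof.
rewrite [leRHS]mx_normrE.
exact: (@le_bigmax _ _ _ _ (fun ij => `|x ij.1 ij.2|) (0, k)).
Qed.

Lemma prod_bump_le (R : realType) (d r : nat) (A h C : R) (a : 'I_d -> R)
    (c : 'I_d -> nat) (x : 'rV[R]_d) : 0 < h -> 0 <= C ->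
  (forall k t, `|bump_deriv r (c k) t| <= C) ->
  `|prod_bump r A h a c x| <= `|A| * h^-1 ^+ msize c * C ^+ d.
Proof.
move=> h0 C0 HC; rewrite prod_bumpE !normrM (ger0_norm (exprn_ge0 _ _)); last first.
  by rewrite invr_ge0 ltW.
apply: ler_wpM2l; first by rewrite mulr_ge0 // exprn_ge0 // invr_ge0 ltW.
have := @prod_bounded R _ (enum 'I_d) (fun k => bump_deriv r (c k) ((x 0 k - a k) / h)) C C0.
by rewrite size_enum_ord big_enum; apply.
Qed.

Lemma prod_bump_lipschitz (R : realType) (d r : nat) (A h C : R)
    (a : 'I_d -> R) (c : 'I_d -> nat) (x y : 'rV[R]_d) : 0 < h -> 0 <= C ->
  (forall k t, `|bump_deriv r (c k) t| <= C) ->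
  (forall k t u, `|bump_deriv r (c k) t - bump_deriv r (c k) u| <= C * `|t - u|) ->
  `|prod_bump r A h a c x - prod_bump r A h a c y| <=
    `|A| * h^-1 ^+ msize c * (d%:R * C ^+ d * (`|x - y| / h)).
Proof.
move=> h0 C0 HC HL; rewrite !prod_bumpE -mulrBr !normrM.
rewrite (ger0_norm (exprn_ge0 _ _)); last by rewrite invr_ge0 ltW.
apply: ler_wpM2l; first by rewrite mulr_ge0 // exprn_ge0 // invr_ge0 ltW.
have := @prod_lipschitz R _ (enum 'I_d)
  (fun k => bump_deriv r (c k) ((x 0 k - a k) / h))
  (fun k => bump_deriv r (c k) ((y 0 k - a k) / h)) C (`|x - y| / h) C0.
rewrite size_enum_ord !big_enum; apply => // k.
rewrite (le_trans (HL _ _ _)) // ler_wpM2l //.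
rewrite -mulrBl normrM [`|h^-1|]gtr0_norm ?invr_gt0 // ler_pM2r ?invr_gt0 //.
have -> : x 0 k - a k - (y 0 k - a k) = (x - y) 0 k by rewrite !mxE; ring.
exact: norm_coord.
Qed.

Lemma continuous_scale_prod (R : realType) (T : topologicalType) (I : finType)
    (A : R) (f : I -> T -> R) : (forall i, continuous (f i)) ->
  continuous (fun x => A * \prod_i f i x).
Proof.
move=> cf x.
have H (s : seq I) : (fun y => \prod_(i <- s) f i y) @ x --> \prod_(i <- s) f i x.
  elim: s => [|i s IH].
    rewrite big_nil (_ : (fun _ => _) = cst 1); first exact: cvg_cst.
    by apply/funext => y; rewrite big_nil.
  rewrite big_cons (_ : (fun _ => _) = f i \* (fun y => \prod_(i <- s) f i y)).
    by apply: cvgM => //; exact: cf.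
  by apply/funext => y; rewrite big_cons.
apply: (@cvgM _ _ _ _ (cst A)); first exact: cvg_cst.
exact: H.
Qed.

Lemma continuous_prod_bump (R : realType) (d r : nat) (A h : R)
    (a : 'I_d -> R) (c : 'I_d -> nat) :
  (forall k, ((c k).+1 < r)%N) -> continuous (prod_bump r A h a c).
Proof.
move=> cr; apply: continuous_scale_prod => k.
pose b (u : R) := h^-1 ^+ c k * bump_deriv r (c k) ((u - a k) / h).
have cb : continuous b.
  move=> u; apply: (@cvgM _ _ _ _ (cst _)); first exact: cvg_cst.
  apply: (@continuous_comp _ _ _ (fun v : R => (v - a k) / h)).
    apply: (@cvgM _ _ _ _ _ (cst _)); last exact: cvg_cst.
    by apply: (@cvgB _ _ _ _ _ _ (cst _)); [exact: cvg_id|exact: cvg_cst].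
  apply: differentiable_continuous; apply/derivable1_diffP.
  by case: (is_derive_bump ((u - a k) / h) (cr k)).
move=> x; apply: (@continuous_comp _ _ _ (fun y : 'rV[R]_d => y 0 k) b).
  exact: coord_continuous.
exact: cb.
Qed.

Lemma mderiv_prod_bump (R : realType) (d r : nat) (A h : R) (a : 'I_d -> R)
    (s : 'I_d -> nat) (x : 'rV[R]_d) : ((msize s).+1 < r)%N -> cube R d x ->
  mderiv s (prod_bump r A h a (fun=> 0%N)) x = prod_bump r A h a s x.
Proof.
move=> sr cx; rewrite /mderiv wpartial_prod_bump ?size_mword; last exact: ltnW.
have -> : (fun k => count_mem k (mword s)) = s.
  by apply/funext => k; rewrite count_mword.
have PF := within_cube_proper cx.
apply: cvg_lim => //; apply: cvg_within_filter.
apply: continuous_prod_bump => k; apply: leq_ltn_trans sr.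
by rewrite ltnS /msize (bigD1 k) //= leq_addr.
Qed.

Lemma Cm_cube_prod_bump (R : realType) (d r m : nat) (A h : R)
    (a : 'I_d -> R) : (m.+1 < r)%N ->
  Cm_cube m (prod_bump r A h a (fun=> 0%N)).
Proof.
move=> mr.
have cw (w : seq 'I_d) : (size w <= m)%N -> forall k, ((count_mem k w).+1 < r)%N.
  by move=> wm k; apply: leq_ltn_trans mr; rewrite ltnS (leq_trans (count_size _ _)).
split.
- apply: continuous_subspaceT; apply: continuous_prod_bump => k.
  exact: leq_ltn_trans mr.
- move=> w k x wm _; rewrite wpartial_prod_bump; last first.
    by apply: leq_trans mr; rewrite ltnW // ltnW.
  apply: (@ex_derive _ _ _ _ _ _ _ (is_derive_prod_bump _ _ _ _ _)).
  exact: cw (ltnW wm) k.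
- move=> w wm; exists (prod_bump r A h a (fun k => count_mem k w)).
    by apply: continuous_subspaceT; apply: continuous_prod_bump; exact: cw.
  move=> x _; rewrite wpartial_prod_bump //.
  by apply: leq_ltn_trans wm _; exact: ltnW.
Qed.

(** Interpolation: the linear bound serves for [u <= 1] and the constant one for
    [u > 1]. *)
Lemma powR_interp (R : realType) (g u P Q D : R) : 0 < g <= 1 -> 0 < u ->
  0 <= P -> 0 <= Q -> D <= P -> D <= Q * u -> D <= (P + Q) * u `^ g.
Proof.
move=> /andP[g0 g1] u0 P0 Q0 DP DQ.
have ug : 0 <= u `^ g by exact: powR_ge0.
have [u1|u1] := leP u 1.
  rewrite (le_trans DQ) // mulrDl.
  have := @ger1_powR R u g; rewrite u0 u1 => /(_ isT g1) ul.
  by rewrite (le_trans (ler_wpM2l Q0 ul)) // lerDr mulr_ge0.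
rewrite (le_trans DP) //.
have u1' : 1 <= u `^ g by rewrite -(powRr0 u) ler_powR // ltW.
by rewrite mulrDl (le_trans (ler_peMr P0 u1')) // lerDl mulr_ge0.
Qed.

(** The power of [h] comes from the rescaling alone: each derivative costs a
    factor [h ^ -1], and the Hoelder quotient of the highest ones costs the
    remaining fractional power, by interpolation between boundedness and
    Lipschitz continuity. Lower derivatives cost less since [h <= 1]. *)
Lemma holder_norm_prod_bump (R : realType) (d r : nat) (al : R) : 0 < al ->
  ((strict_floor al).+1 < r)%N ->
  exists2 K : R, 0 < K & forall (A h : R) (a : 'I_d -> R), 0 < h <= 1 ->
    (holder_norm al (prod_bump r A h a (fun=> 0%N)) <=
      (`|A| * h `^ (- al) * K)%:E)%E.
Proof.
move=> al0; set m := strict_floor al => mr.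
have [C C1 HC] := bump_const R r.
have C0 : 0 < C by exact: lt_le_trans C1.
have Cd0 : 0 < C ^+ d by rewrite exprn_gt0.
(* 2 C^d bounds the increments of the bump at large distances, and
   d C^d is its Lipschitz constant *)
pose K2 : R := 2 * C ^+ d + d%:R * C ^+ d.
exists (C ^+ d + K2).
  by rewrite addr_gt0 // ltr_wpDr ?mulr_gt0 // mulr_ge0 // ltW.
move=> A h a /andP[h0 h1].
have hV1 : 1 <= h^-1 by rewrite invf_ge1.
have hV0 : 0 <= h^-1 by rewrite invr_ge0 ltW.
pose g := al - m%:R.
have g01 : 0 < g <= 1.
  rewrite subr_gt0 strict_floor_lt //= lerBlDr addrC.
  by have := le_strict_floorS al0; rewrite -natr1 addrC.
have hal : h `^ (- al) = h^-1 ^+ m * h `^ (- g).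
  rewrite exprVn -powR_invn ?(ltW h0) // -powRD; last by rewrite (gt_eqF h0) implybT.
  by congr (_ `^ _); rewrite /g; ring.
have hg1 : 1 <= h `^ (- g).
  have /andP[g0 _] := g01.
  rewrite powRN invf_ge1 ?powR_gt0 // -[leRHS](powRr0 h).
  by apply: ger_powR; rewrite ?h0 ?h1 // ltW.
have cr (k : 'I_d -> nat) : (msize k <= m)%N -> forall i, ((k i).+1 < r)%N.
  move=> km i; apply: leq_ltn_trans mr; rewrite ltnS; apply: leq_trans km.
  by rewrite /msize (bigD1 i) //= leq_addr.
rewrite mulrDr EFinD; apply: leeD.
  apply: ge_ereal_sup => _ [k /= km <-]; apply: ge_ereal_sup => _ [x cx <-].
  rewrite lee_fin mderiv_prod_bump //; last exact: leq_ltn_trans mr.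
  apply: (@le_trans _ _ (`|A| * h^-1 ^+ msize k * C ^+ d)).
    apply: prod_bump_le => // [|i t]; first exact: ltW.
    by have [H _] := HC _ (cr k km i); exact: H.
  rewrite ler_pM2r // ler_wpM2l // hal.
  rewrite (le_trans (ler_weXn2l hV1 km)) // ler_peMr //.
  by rewrite exprn_ge0.
apply: ge_ereal_sup => _ [k /= km <-].
apply: ge_ereal_sup => _ [[x y] /= [cx cy xy] <-].
have {}km : msize k = m by [].
rewrite lee_fin !mderiv_prod_bump ?km //.
have xy0 : 0 < `|x - y| by rewrite normr_gt0 subr_eq0.
rewrite ler_pdivrMr ?powR_gt0 //.
have kr : forall i, ((k i).+1 < r)%N by apply: cr; rewrite km.
have B1 i t : `|bump_deriv r (k i) t| <= C by have [H _] := HC _ (kr i); exact: H.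
have B2 i t u : `|bump_deriv r (k i) t - bump_deriv r (k i) u| <= C * `|t - u|.
  by have [_ H] := HC _ (kr i); exact: H.
pose Q := `|A| * h^-1 ^+ m.
have Q0 : 0 <= Q by rewrite mulr_ge0 // exprn_ge0.
have := @powR_interp R g (`|x - y| / h) (Q * (2 * C ^+ d)) (Q * (d%:R * C ^+ d)) 
  `|prod_bump r A h a k x - prod_bump r A h a k y| g01.
rewrite divr_gt0 // !(mulr_ge0 Q0) ?mulr_ge0 ?(ltW Cd0) // => /(_ isT isT isT) H.
apply: le_trans (H _ _) _.
- rewrite (le_trans (ler_normB _ _)) // mulrCA mulr_natl mulr2n /Q -km.
  by apply: lerD; apply: prod_bump_le => //; exact: ltW.
- rewrite -!mulrA [C ^+ d * _]mulrA mulrA /Q -km -!mulrA.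
  have := @prod_bump_lipschitz R d r A h C a k x y h0 (ltW C0) B1 B2.
  by rewrite -!mulrA.
rewrite powRM ?invr_ge0 ?(ltW h0) // -mulrDr -/K2 hal.
have -> : h^-1 `^ g = h `^ (- g).
  by rewrite -powR_inv1 ?(ltW h0) // -powRrM mulN1r.
rewrite le_eqVlt /Q /g -/m; apply/orP; left; apply/eqP; ring.
Qed.

(** What the lower bounds need to know about the bumps [F A h a] of height [A],
    width [h] and lower corner [a]: the constants do not depend on the bump,
    and the derivative of order [s] is known at the point with relative
    position [tau]. *)
Record bump_system (R : realType) (d : nat) (al be : R) (s : 'I_d -> nat)
    (F : R -> R -> ('I_d -> R) -> 'rV[R]_d -> R) (C D kap : R) (tau : 'I_d -> R) :
    Prop := BumpSystem {
  bs_C : 0 < C;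
  bs_D : 0 < D;
  bs_kap : 0 < kap;
  bs_tau : forall k, 0 < tau k < 1;
  bs_scale : forall c A h a x, c * F A h a x = F (c * A) h a x;
  bs_Cm_al : forall A h a, Cm_cube (strict_floor al) (F A h a);
  bs_Cm_be : forall A h a, Cm_cube (strict_floor be) (F A h a);
  bs_holder_al : forall (A h : R) a, 0 < h <= 1 ->
    (holder_norm al (F A h a) <= (`|A| * h `^ (- al) * C)%:E)%E;
  bs_holder_be : forall (A h : R) a, 0 < h <= 1 ->
    (holder_norm be (F A h a) <= (`|A| * h `^ (- be) * C)%:E)%E;
  bs_bound : forall (A h : R) a x, 0 < h -> `|F A h a x| <= `|A| * D;
  bs_support : forall (A h : R) a (x : 'rV[R]_d) k, 0 < h -> ~~ (a k < x 0 k < a k + h) ->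
    F A h a x = 0;
  bs_mderiv0 : forall u, cube R d u -> mderiv s (fun _ : 'rV[R]_d => (0 : R)) u = 0;
  bs_mderiv : forall (A h : R) a (x : 'rV[R]_d), 0 < h -> cube R d x ->
    (forall k, x 0 k = a k + h * tau k) ->
    `|mderiv s (F A h a) x| = `|A| * h `^ (- (msize s)%:R) * kap }.

Lemma bump_system_exists (R : realType) (d : nat) (al be : R) (s : 'I_d -> nat) :
  0 < al -> 0 < be -> exists F C D kap tau, @bump_system R d al be s F C D kap tau.
Proof.
move=> al0 be0.
(* the derivatives of order below r - 1 are Lipschitz continuous *)
pose r := (maxn (maxn (strict_floor al) (strict_floor be)) (msize s)).+2.
have ra : ((strict_floor al).+1 < r)%N by rewrite /r; lia.
have rb : ((strict_floor be).+1 < r)%N by rewrite /r; lia.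
have rs : ((msize s).+1 < r)%N by rewrite /r; lia.
have [Ca Ca0 HCa] := holder_norm_prod_bump d al0 ra.
have [Cb Cb0 HCb] := holder_norm_prod_bump d be0 rb.
have [B B1 HB] := bump_const R r.
have sk k : (s k <= msize s)%N by rewrite /msize (bigD1 k) //= leq_addr.
have /choice[tau Htau] : forall k, exists t : R, 0 < t < 1 /\ bump_deriv r (s k) t != 0.
  move=> k; have [|t t01 tn0] := @bump_nonzero R r (s k); last by exists t.
  by have := sk k; lia.
exists (fun A h a => prod_bump r A h a (fun=> 0%N)), (Num.max Ca Cb), (B ^+ d),
  (\prod_k `|bump_deriv r (s k) (tau k)|), tau.
have scale c A h a x : c * prod_bump r A h a (fun=> 0%N) x =
   prod_bump r (c * A) h a (fun=> 0%N) x :> R by rewrite /prod_bump mulrA.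
split=> //.
- by rewrite lt_max Ca0.
- by rewrite exprn_gt0 // (lt_le_trans _ B1).
- by apply: prodr_gt0 => k _; rewrite normr_gt0; have [] := Htau k.
- by move=> k; have [] := Htau k.
- by move=> A h a; exact: Cm_cube_prod_bump.
- by move=> A h a; exact: Cm_cube_prod_bump.
- move=> A h a h01; apply: le_trans (HCa A h a h01) _; rewrite lee_fin.
  by rewrite ler_wpM2l ?le_max ?lexx // mulr_ge0 ?powR_ge0.
- move=> A h a h01; apply: le_trans (HCb A h a h01) _; rewrite lee_fin.
  by rewrite ler_wpM2l ?le_max ?lexx ?orbT // mulr_ge0 ?powR_ge0.
- move=> A h a x h0.
  have := @prod_bump_le R d r A h B a (fun=> 0%N) x h0 (le_trans ler01 B1).
  have -> : msize (fun _ : 'I_d => 0%N) = 0%N by rewrite /msize big1.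
  rewrite expr0 mulr1; apply => k t.
  by have [H _] := HB 0%N isT; exact: H.
- move=> A h a x k h0 nx; rewrite /prod_bump (bigD1 k) //=.
  suff -> : bump_deriv r 0 ((x 0 k - a k) / h) = 0 by rewrite mulr0 mul0r mulr0.
  rewrite /bump_deriv; case: ifP => // /andP[u0 u1].
  rewrite bump_poly_deriv_end //.
  move: nx; rewrite negb_and -!leNgt => /orP[H|H].
    by rewrite [_ == 0]eq_le u0 pmulr_lle0 ?invr_gt0 // subr_le0 H.
  by rewrite [_ == 1]eq_le u1 ler_pdivlMr // mul1r lerBrDl H orbT.
- move=> u cu.
  have -> : (fun _ : 'rV[R]_d => (0:R)) = prod_bump r 0 1 (fun=> 0) (fun=> 0%N).
    by apply/funext => y; rewrite /prod_bump mul0r.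
  by rewrite mderiv_prod_bump // /prod_bump mul0r.
- move=> A h a x h0 cx Hx; rewrite mderiv_prod_bump // prod_bumpE !normrM.
  rewrite powR_invn ?(ltW h0) // -exprVn.
  rewrite (ger0_norm (exprn_ge0 _ _)) ?invr_ge0 ?(ltW h0) //; congr (_ * _).
  rewrite normr_prod; apply: eq_bigr => k _; congr `|bump_deriv _ _ _|.
  by rewrite Hx addrAC subrr add0r mulrC mulKf // gt_eqF.
Qed.

(** * Measures with a density *)

Lemma density_measure (R : realType) (dd : measure_display)
    (T : measurableType dd) (mu : {measure set T -> \bar R}) (f : T -> R) :
  measurable_fun [set: T] f -> (forall x, 0 <= f x) ->
  exists nu : {measure set T -> \bar R},
    forall A, nu A = (\int[mu]_(x in A) (f x)%:E)%E.
Proof.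
move=> mf f0.
pose D A : \bar R := (\int[mu]_(x in A) (f x)%:E)%E.
have D0 : D set0 = 0%E by rewrite /D integral_set0.
have Dge0 A : (0 <= D A)%E by apply: integral_ge0 => x _; rewrite lee_fin.
have Dsigma : semi_sigma_additive D.
  move=> /= F mF tF mUF; rewrite /D; apply: cvg_toP.
    apply: ereal_nondecreasing_is_cvgn => m n mn.
    by apply: lee_sum_nneg_natr => // k _ _; exact: Dge0.
  rewrite ge0_integral_bigcup//=.
  - by apply/measurable_EFinP; exact: measurable_funTS.
  - by move=> x _; rewrite lee_fin.
pose nu : {measure set T -> \bar R} :=
  HB.pack D (isMeasure.Build _ _ _ D D0 Dge0 Dsigma).
by exists nu.
Qed.

Import HBNNSimple.

(** Holds for indicators by definition, hence for simple functions by
    linearity, and in general by monotone convergence. *)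
Lemma integral_density (R : realType) (dd : measure_display)
    (T : measurableType dd) (mu nu : {measure set T -> \bar R}) (f : T -> R)
    (g : T -> \bar R) :
  measurable_fun [set: T] f -> (forall x, 0 <= f x) ->
  (forall A, measurable A -> nu A = (\int[mu]_(x in A) (f x)%:E)%E) ->
  measurable_fun [set: T] g -> (forall x, 0 <= g x)%E ->
  (\int[nu]_x g x = \int[mu]_x (g x * (f x)%:E))%E.
Proof.
move=> mf f0 nuE mg g0.
have ind (E : set T) : measurable E ->
    (\int[nu]_x (\1_E x)%:E = \int[mu]_x ((\1_E x)%:E * (f x)%:E))%E.
  move=> mE; rewrite integral_indic// setIT nuE // integral_mkcond.
  apply: eq_integral => x _; rewrite patchE indicE.
  by case: (x \in E); rewrite ?mul1e ?mul0e.
have sfun (h : {nnsfun T >-> R}) :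
    (\int[nu]_x (h x)%:E = \int[mu]_x ((h x)%:E * (f x)%:E))%E.
  under [LHS]eq_integral do rewrite fimfunE -fsumEFin//.
  rewrite [LHS]ge0_integral_fsum//; last 2 first.
    - by move=> r; exact/measurable_EFinP/measurableT_comp.
    - by move=> n x _; rewrite EFinM nnfun_muleindic_ge0.
  under [RHS]eq_integral.
    move=> x xD; rewrite fimfunE -fsumEFin// muleC ge0_mule_fsumr; last first.
      by move=> r; rewrite EFinM nnfun_muleindic_ge0.
    over.
  rewrite [RHS]ge0_integral_fsum//; last 2 first.
    - move=> r; apply: emeasurable_funM; first exact/measurable_EFinP.
      by apply/measurable_EFinP; apply/measurableT_comp => //.
    - move=> n x _; rewrite EFinM mule_ge0//; first by rewrite lee_fin.
      by rewrite nnfun_muleindic_ge0.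
  apply: eq_fsbigr => r rh.
  have [r0|r0] := leP 0 r; last first.
    have hr0 : h @^-1` [set r] = set0.
      apply/seteqP; split=> x //= hx.
      by have : 0 <= h x by []; rewrite hx leNgt r0.
    rewrite hr0.
    under eq_integral do rewrite indic0 mulr0.
    under [in RHS]eq_integral do rewrite indic0 mulr0 mule0.
    by rewrite !integral0.
  under eq_integral do rewrite EFinM.
  rewrite ge0_integralZl//; last first.
    - by apply/measurable_EFinP.
  rewrite ind // -ge0_integralZl//; last 2 first.
    - by apply: emeasurable_funM; apply/measurable_EFinP => //.
    - by move=> x _; rewrite mule_ge0 // lee_fin.
  by apply: eq_integral => x _; rewrite EFinM muleA [RHS]muleC.
pose g_ := nnsfun_approx measurableT mg.
transitivity (lim (\int[nu]_x (g_ n x)%:E @[n --> \oo])%E).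
  rewrite -monotone_convergence//=.
  - apply: eq_integral => ? /[!inE] xD; apply/esym/cvg_lim => //=.
    exact: cvg_nnsfun_approx.
  - by move=> n; exact/measurable_EFinP/measurable_funTS.
  - by move=> n ? _; rewrite lee_fin.
  - by move=> ? _ ? ? mn; rewrite lee_fin; exact/lefP/nd_nnsfun_approx.
transitivity (lim (\int[mu]_x ((g_ n x)%:E * (f x)%:E) @[n --> \oo])%E).
  by apply: congr_lim; apply/funext => n /=; exact: sfun.
rewrite -monotone_convergence//=.
- apply: eq_integral => x _; apply/cvg_lim => //.
  apply: cvgeZr => //; exact: cvg_nnsfun_approx.
- by move=> n; apply: emeasurable_funM; exact/measurable_EFinP.
- by move=> n x _; rewrite mule_ge0 // lee_fin.
- move=> x _ a b ab; apply: lee_wpmul2r; rewrite lee_fin //.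
  exact/lefP/nd_nnsfun_approx.
Qed.

(** * Independent families *)

(** Independence is expressed by the product formula for nonnegative functions
    of the coordinates, the form in which likelihood ratios use it. The
    induction adds one factor to a product space. *)
Lemma iid_sequence (R : realType) (nu : probability (measurableTypeR R) R) (n : nat) :
  exists (dd : measure_display) (Omega : measurableType dd)
    (P : probability Omega R) (X : 'I_n -> Omega -> R),
    (forall i, measurable_fun [set: Omega] (X i)) /\
    forall f : 'I_n -> R -> R,
      (forall i, measurable_fun [set: R] (f i)) ->
      (forall i x, 0 <= f i x) ->
      (\int[P]_w (\prod_i f i (X i w))%:E = \prod_i \int[nu]_x (f i x)%:E)%E.
Proof.
elim: n => [|n [dd [Om [P [X [mX IH]]]]]].
  exists _, unit, (dirac tt : probability unit R), (fun _ _ => 0).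
  split=> [[]//|f mf f0].
  under eq_integral do rewrite big_ord0.
  by rewrite big_ord0 integral_cst //= diracT mule1.
pose X' (i : 'I_n.+1) (w : Om * measurableTypeR R) : R :=
  if unlift ord0 i is Some j then X j w.1 else w.2.
have X'0 w : X' ord0 w = w.2 by rewrite /X' unlift_none.
have X'S j w : X' (lift ord0 j) w = X j w.1 by rewrite /X' liftK.
exists _, (Om * measurableTypeR R)%type, (P \x nu)%E, X'; split.
  move=> i; rewrite /X'; case: (unlift ord0 i) => [j|]; last exact: measurable_snd.
  by apply: measurableT_comp (mX j) _; exact: measurable_fst.
move=> f mf f0.
pose G (w : Om) : R := \prod_j f (lift ord0 j) (X j w).
have mG : measurable_fun [set: Om] G.
  by apply: measurable_prod => j _; apply: measurableT_comp (mX j).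
have G0 w : 0 <= G w by apply: prodr_ge0.
have E : (fun w => (\prod_i f i (X' i w))%:E) =
   (fun w : Om * measurableTypeR R => (f ord0 w.2)%:E * (G w.1)%:E)%E.
  apply/funext => w; rewrite big_ord_recl X'0 EFinM; congr (_ * (_)%:E)%E.
  by apply: eq_bigr => j _; rewrite X'S.
rewrite E fubini_tonelli1 /=; last 2 first.
  - apply: emeasurable_funM; apply/measurable_EFinP.
    + by apply: measurableT_comp (mf ord0) _; exact: measurable_snd.
    + by apply: measurableT_comp mG _; exact: measurable_fst.
  - by move=> w; rewrite mule_ge0 // lee_fin.
rewrite /fubini_F /=.
transitivity (\int[P]_w ((\int[nu]_x (f ord0 x)%:E) * (G w)%:E))%E.
  apply: eq_integral => w _; rewrite ge0_integralZr // ?lee_fin //.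
    by apply/measurable_EFinP; exact: (mf ord0).
  by move=> x _; rewrite lee_fin.
rewrite ge0_integralZl //.
- by rewrite big_ord_recl /G (IH (fun j => f (lift ord0 j))).
- exact/measurable_EFinP.
- by move=> w _; rewrite lee_fin.
- by apply: integral_ge0 => x _; rewrite lee_fin.
Qed.

Lemma iid_family (R : realType) (nu : probability (measurableTypeR R) R) (I : finType) :
  exists (dd : measure_display) (Omega : measurableType dd)
    (P : probability Omega R) (X : I -> Omega -> R),
    (forall i, measurable_fun [set: Omega] (X i)) /\
    forall f : I -> R -> R,
      (forall i, measurable_fun [set: R] (f i)) ->
      (forall i x, 0 <= f i x) ->
      (\int[P]_w (\prod_i f i (X i w))%:E = \prod_i \int[nu]_x (f i x)%:E)%E.
Proof.
have [dd [Om [P [X [mX HX]]]]] := iid_sequence nu #|I|.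
exists dd, Om, P, (fun i => X (enum_rank i)); split=> // f mf f0.
have re (S : Type) (z : S) (op : Monoid.com_law z) (g : 'I_#|I| -> S) :
    \big[op/z]_k g k = \big[op/z]_(i : I) g (enum_rank i).
  by rewrite (reindex _ (onW_bij _ (enum_rank_bij I))).
transitivity (\int[P]_w (\prod_k f (enum_val k) (X k w))%:E)%E.
  apply: eq_integral => w _; rewrite re; congr (_%:E).
  by apply: eq_bigr => i _; rewrite enum_rankK.
rewrite (HX (fun k => f (enum_val k))) // re.
by apply: eq_bigr => i _; rewrite enum_rankK.
Qed.

(** * Gaussian shifts *)

(** The likelihood ratio of N(m, s^2) with respect to N(0, s^2). *)
Definition gauss_lr (R : realType) (s m x : R) : R :=
  expR (m * x / s ^+ 2 - m ^+ 2 / (s ^+ 2 *+ 2)).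

Lemma measurable_gauss_lr (R : realType) (s m : R) :
  measurable_fun [set: R] (gauss_lr s m).
Proof.
apply: measurableT_comp; first exact: measurable_expR.
by apply: measurable_funB => //; apply: measurable_funM => //; apply: measurable_funM.
Qed.

Lemma gauss_lr_ge0 (R : realType) (s m x : R) : 0 <= gauss_lr s m x.
Proof. exact: expR_ge0. Qed.

Lemma invr_double (R : realType) (v : R) : v^-1 = 2 * (v *+ 2)^-1.
Proof.
by rewrite -[v *+ 2]mulr_natl invfM mulrA mulfV ?mul1r // pnatr_eq0.
Qed.

Lemma gauss_lrM (R : realType) (s m m' x : R) :
  gauss_lr s m x * gauss_lr s m' x =
  expR (m * m' / s ^+ 2) * gauss_lr s (m + m') x.
Proof.
rewrite /gauss_lr -!expRD; congr expR.
rewrite [(s ^+ 2)^-1]invr_double.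
by move: (_^-1) => v; ring.
Qed.

Lemma gauss_lr_pdf (R : realType) (s m x : R) : s != 0 ->
  normal_pdf 0 s x * gauss_lr s m x = normal_pdf m s x.
Proof.
move=> s0; rewrite !normal_pdfE //= -[LHS]mulrA /normal_fun /gauss_lr -expRD.
congr (_ * expR _).
rewrite [(s ^+ 2)^-1]invr_double.
by move: (_^-1) => v; ring.
Qed.

Lemma integral_gauss_lr (R : realType) (s m : R) (B : set R) : s != 0 ->
  measurable B ->
  (\int[normal_prob 0 s]_(x in B) (gauss_lr s m x)%:E = normal_prob m s B)%E.
Proof.
move=> s0 mB; rewrite integral_mkcond.
rewrite (@integral_density _ _ _ lebesgue_measure _ (normal_pdf 0 s)) //.
- rewrite /normal_prob [RHS]integral_mkcond; apply: eq_integral => x _.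
  rewrite !patchE; case: ifP => _; last by rewrite mul0e.
  by rewrite -EFinM mulrC gauss_lr_pdf.
- exact: measurable_normal_pdf.
- by move=> x; exact: normal_pdf_ge0.
- apply/(measurable_restrictT _ _).1 => //.
  by apply/measurable_EFinP; apply: measurable_funTS; exact: measurable_gauss_lr.
- by move=> x; rewrite patchE; case: ifP => // _; rewrite lee_fin gauss_lr_ge0.
Qed.

(** Both sides are measures that agree on intervals. *)
Lemma lebesgue_measure_shift (R : realType) (m : R) (A : set R) : measurable A ->
  lebesgue_measure ((fun x : R => x - m) @^-1` A) = lebesgue_measure A.
Proof.
move=> mA.
pose f : measurableTypeR R -> measurableTypeR R := fun x : R => x - m.
have mf : measurable_fun [set: measurableTypeR R] f by exact: measurable_funB.
have /(_ mf) H := @lebesgue_measure_unique R (pushforward lebesgue_measure f).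
apply/esym; apply: H => // X [[a b] _ <-].
rewrite /= /pushforward lebesgue_measure_itv /=.
have -> : f @^-1` `]a, b]%classic = `](a + m), (b + m)]%classic.
  by apply/seteqP; split=> x /=; rewrite /f !in_itv /= ltrBrDr lerBlDr.
rewrite lebesgue_measure_itv /= !lte_fin ltrD2r; case: ifP => // _.
by rewrite -!EFinB; congr (_%:E); ring.
Qed.

Lemma lebesgue_measure_opp (R : realType) (A : set R) : measurable A ->
  lebesgue_measure ((fun x : R => - x) @^-1` A) = lebesgue_measure A.
Proof.
move=> mA.
pose f : measurableTypeR R -> measurableTypeR R := fun x : R => - x.
have mf : measurable_fun [set: measurableTypeR R] f by exact: measurableT_comp.
have /(_ mf) H := @lebesgue_measure_unique R (pushforward lebesgue_measure f).
apply/esym; apply: H => // X [[a b] _ <-].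
rewrite /= /pushforward lebesgue_measure_itv /=.
have -> : f @^-1` `]a, b]%classic = `[- b, - a[%classic.
  by apply/seteqP; split=> x /=; rewrite /f !in_itv /= lerNl ltrNr andbC.
rewrite lebesgue_measure_itv /= !lte_fin ltrN2; case: ifP => // _.
by rewrite -!EFinB; congr (_%:E); ring.
Qed.

(** A map that preserves Lebesgue measure and carries one Gaussian density to
    another carries the one Gaussian law to the other; used for translations
    and for the reflection at 0. *)
Lemma normal_prob_preimage (R : realType) (s m m' : R) (f : R -> R) (A : set R) :
  measurable_fun [set: R] f ->
  (forall B, measurable B -> lebesgue_measure (f @^-1` B) = lebesgue_measure B) ->
  (forall x, normal_pdf m s x = normal_pdf m' s (f x)) ->
  measurable A -> normal_prob m s (f @^-1` A) = normal_prob m' s A.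
Proof.
move=> mf lf pf mA; rewrite /normal_prob.
have p0 : {in A, forall y, 0 <= (normal_pdf m' s y)%:E}%E.
  by move=> y _; rewrite lee_fin normal_pdf_ge0.
have mp : measurable_fun A (fun x => (normal_pdf m' s x)%:E).
  by apply/measurable_EFinP; apply: measurable_funTS; exact: measurable_normal_pdf.
transitivity (\int[lebesgue_measure]_(x in f @^-1` A)
    ((fun x => (normal_pdf m' s x)%:E) \o f) x)%E.
  by apply: eq_integral => x _ /=; rewrite pf.
pose f' : measurableTypeR R -> measurableTypeR R := f.
have mf' : measurable_fun [set: measurableTypeR R] f' by [].
rewrite -(@ge0_integral_pushforward _ _ _ _ R f' mf' lebesgue_measure A _ mA mp p0).
by apply: eq_measure_integral => B mB _; rewrite /= /pushforward lf.
Qed.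

Lemma normal_prob_shift (R : realType) (s m : R) (A : set R) :
  s != 0 -> measurable A ->
  normal_prob m s ((fun x : R => x - m) @^-1` A) = normal_prob 0 s A.
Proof.
move=> s0; apply: normal_prob_preimage.
- exact: measurable_funB.
- exact: lebesgue_measure_shift.
- by move=> x; rewrite !normal_pdfE //= /normal_fun subr0.
Qed.

Lemma normal_prob_opp (R : realType) (s : R) (A : set R) :
  s != 0 -> measurable A ->
  normal_prob 0 s ((fun x : R => - x) @^-1` A) = normal_prob 0 s A.
Proof.
move=> s0; apply: normal_prob_preimage.
- exact: measurableT_comp.
- exact: lebesgue_measure_opp.
- by move=> x; rewrite !normal_pdfE //= /normal_fun !subr0 sqrrN.
Qed.

Lemma sqr_le_expR (R : realType) (x : R) : x ^+ 2 <= 4 * (expR x + expR (- x)).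
Proof.
wlog x0 : x / 0 <= x.
  move=> H; have [/H//|/ltW x0] := leP 0 x.
  by have := H (- x); rewrite sqrrN opprK addrC oppr_ge0; apply.
have h : x / 2 <= expR (x / 2).
  by apply: le_trans (expR_ge1Dx _); rewrite lerDr.
have h2 : (x / 2) ^+ 2 <= expR x.
  have -> : expR x = expR (x / 2) ^+ 2 by rewrite -expRM_natl; congr expR; lra.
  by rewrite ler_pXn2r // ?nnegrE ?expR_ge0 // divr_ge0.
have := expR_ge0 (- x); lra.
Qed.

(** The square is dominated by [exp x + exp (- x)], whose Gaussian integrals
    are known because the likelihood ratios with shifts [s ^ 2] and [- s ^ 2]
    have mean 1. *)
Lemma normal_second_moment (R : realType) (s : R) : s != 0 ->
  exists2 V : R, 0 < V &
    (\int[normal_prob 0 s]_x (x ^+ 2)%:E <= V%:E)%E.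
Proof.
move=> s0; pose k := 4 * expR (s ^+ 2 / 2).
have k0 : 0 < k by rewrite mulr_gt0 ?expR_gt0.
exists (k + k); first by rewrite addr_gt0.
have s20 : s ^+ 2 != 0 by rewrite expf_neq0.
have lrE (e x : R) : e ^+ 2 = 1 ->
    4 * expR (e * x) = k * gauss_lr s (e * s ^+ 2) x.
  move=> e1; rewrite /k /gauss_lr -mulrA -expRD; congr (_ * expR _).
  rewrite exprMn e1 mul1r; move: (s ^+ 2) s20 => v v0.
  have -> : (v *+ 2)^-1 = v^-1 / 2 by rewrite -[v *+ 2]mulr_natr invfM.
  have vw : v * v^-1 = 1 by rewrite divff.
  move: (v^-1) vw => w vw.
  have -> : e * v * x * w = e * x * (v * w) by ring.
  have -> : v ^+ 2 * (w / 2) = v * (v * w) / 2 by ring.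
  by rewrite vw; ring.
have bound (x : R) : x ^+ 2 <= k * gauss_lr s (1 * s ^+ 2) x +
    k * gauss_lr s (- 1 * s ^+ 2) x.
  by rewrite -!lrE ?sqrrN ?expr1n // mul1r mulN1r -mulrDr sqr_le_expR.
have mg (e : R) : measurable_fun [set: R] (fun x => (k * gauss_lr s e x)%:E).
  by apply/measurable_EFinP; apply: measurable_funM => //; exact: measurable_gauss_lr.
have ig (e : R) : (\int[normal_prob 0 s]_x (k * gauss_lr s e x)%:E = k%:E)%E.
  under eq_integral do rewrite EFinM.
  rewrite ge0_integralZl //.
  - by rewrite integral_gauss_lr // probability_setT mule1.
  - by apply/measurable_EFinP; exact: measurable_gauss_lr.
  - by move=> x _; rewrite lee_fin gauss_lr_ge0.
  - by rewrite lee_fin ltW.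
have gg0 (e x : R) : (0 <= (k * gauss_lr s e x)%:E)%E.
  by rewrite lee_fin mulr_ge0 ?gauss_lr_ge0 // ltW.
rewrite EFinD -{1}(ig (1 * s ^+ 2)) -(ig (- 1 * s ^+ 2)).
rewrite -ge0_integralD //; [|exact: mg|exact: mg].
apply: ge0_le_integral => //.
- by move=> x _; rewrite lee_fin sqr_ge0.
- by apply/measurable_EFinP; exact: measurable_funX.
- by apply: emeasurable_funD; exact: mg.
- by move=> x _; rewrite -EFinD lee_fin bound.
Qed.

Lemma normal_integrable (R : realType) (s : R) : s != 0 ->
  (normal_prob 0 s).-integrable [set: R] (fun x : R => x%:E).
Proof.
move=> s0; have [V _ HV] := normal_second_moment s0.
apply/integrableP; split; first exact/measurable_EFinP.
apply: (@le_lt_trans _ _ (\int[normal_prob 0 s]_x (1 + (x ^+ 2)%:E))%E).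
  apply: ge0_le_integral => //.
  - exact/measurableT_comp/measurable_EFinP.
  - apply: emeasurable_funD => //.
    by apply/measurable_EFinP; exact: measurable_funX.
  - move=> x _; rewrite -EFinD lee_fin.
    by rewrite ler_norml; apply/andP; split; nra.
rewrite ge0_integralD //; last 2 first.
  - by move=> x _; rewrite lee_fin sqr_ge0.
  - by apply/measurable_EFinP; exact: measurable_funX.
rewrite integral_cst // mul1e [X in (X + _)%E](@probability_setT _ _ _ (normal_prob 0 s)).
by rewrite lte_add_pinfty ?ltry // (le_lt_trans HV) // ltry.
Qed.

(** The law is invariant under reflection, so the mean equals its opposite. *)
Lemma normal_mean (R : realType) (s : R) : s != 0 ->
  (\int[normal_prob 0 s]_x (x : R)%:E = 0)%E.
Proof.
move=> s0; have int := normal_integrable s0.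
pose f : measurableTypeR R -> measurableTypeR R := fun x : R => - x.
have mf : measurable_fun [set: measurableTypeR R] f by exact: measurableT_comp.
have E : (\int[normal_prob 0 s]_x (x : R)%:E = \int[normal_prob 0 s]_x (- x)%:E)%E.
  have mE : measurable_fun [set: measurableTypeR R] (fun x : R => x%:E).
    exact/measurable_EFinP.
  have intf : (normal_prob 0 s).-integrable (f @^-1` [set: R])
      ((fun x : R => x%:E) \o f).
    by have := integrableN int; apply: eq_integrable => // x _.
  have H := @integral_pushforward _ _ _ _ R f mf (normal_prob 0 s) [set: R]
    (fun x : R => x%:E) mE intf measurableT.
  rewrite (_ : (\int[normal_prob 0 s]_x (- x)%:E)%E =
    (\int[normal_prob 0 s]_(x in f @^-1` [set: R]) (((fun x : R => x%:E) \o f) x))%E) //.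
  rewrite -H; apply: eq_measure_integral => B mB _.
  by rewrite /= /pushforward normal_prob_opp.
have fin : (\int[normal_prob 0 s]_x (x : R)%:E)%E \is a fin_num.
  exact: integrable_fin_num.
move: E; under [X in _ = X -> _]eq_integral do rewrite EFinN.
rewrite integralN; last exact: integrable_add_def.
move: fin; case: (\int[_]_x _)%E => // r _ [] E; congr (_%:E); lra.
Qed.

(** * Tilting an independent Gaussian family *)

(** The sets with measurable preimage form a sigma-algebra that contains the
    generating cylinders. *)
Lemma cylinder_preimage (R : realType) (dd : measure_display)
    (Omega : measurableType dd) (T : Type) (D : set T) (F : Omega -> T -> R)
    (A : set (T -> R)) :
  (forall t, D t -> measurable_fun [set: Omega] (fun w => F w t)) ->
  cylinder_sigma D A -> measurable (F @^-1` A).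
Proof.
move=> mF.
suff : cylinder_sigma D `<=` [set A | measurable (F @^-1` A)] by apply.
apply: smallest_sub; last first.
  move=> _ [t Dt [B mB ->]].
  by have := mF t Dt measurableT B mB; rewrite setTI.
split=> [|C mC|C mC] /=.
- by rewrite preimage_set0.
- by rewrite setTD preimage_setC; exact: measurableC.
- by rewrite preimage_bigcup; exact: bigcupT_measurable.
Qed.

(** Independence and the common law N(0, s^2) are both contained in the product
    formula for nonnegative functions. *)
Definition iid_normal (R : realType) (s : R) (dd : measure_display)
    (Omega : measurableType dd) (P : probability Omega R) (I : finType)
    (X : I -> Omega -> R) : Prop :=
  (forall i, measurable_fun [set: Omega] (X i)) /\
  forall f : I -> R -> R,
    (forall i, measurable_fun [set: R] (f i)) -> (forall i x, 0 <= f i x) ->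
    (\int[P]_w (\prod_i f i (X i w))%:E =
     \prod_i \int[normal_prob 0%R s]_x (f i x)%:E)%E.

Definition product_lr (R : realType) (s : R) (Omega : Type) (I : finType)
    (X : I -> Omega -> R) (m : I -> R) (w : Omega) : R :=
  \prod_i gauss_lr s (m i) (X i w).

Section iid_normal_theory.
Context {R : realType} {s : R} {dd : measure_display}
  {Omega : measurableType dd} {P : probability Omega R} {I : finType}
  {X : I -> Omega -> R}.
Hypothesis s0 : s != 0.
Hypothesis iidX : iid_normal s P X.

Lemma measurable_product_lr (m : I -> R) : measurable_fun [set: Omega] (product_lr s X m).
Proof.
apply: measurable_prod => i _; apply: measurableT_comp (iidX.1 i).
exact: measurable_gauss_lr.
Qed.

Lemma product_lr_ge0 (m : I -> R) w : 0 <= product_lr s X m w.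
Proof. by apply: prodr_ge0 => i _; exact: gauss_lr_ge0. Qed.

(** On a product set the likelihood ratio and the indicator both factor over
    the coordinates, and each factor gives the shifted Gaussian law. *)
Lemma integral_product_lr_cylinder (m : I -> R) (B : I -> set R) :
  (forall i, measurable (B i)) ->
  (\int[P]_(w in \bigcap_(i in [set: I]) X i @^-1` B i) (product_lr s X m w)%:E =
   \prod_i normal_prob (m i) s (B i))%E.
Proof.
move=> mB; rewrite integral_mkcond.
transitivity (\int[P]_w (\prod_i (\1_(B i) (X i w) * gauss_lr s (m i) (X i w)))%:E)%E.
  apply: eq_integral => w _; rewrite patchE big_split /= -/(product_lr s X m w).
  case: ifPn => [|].
    rewrite inE => H; rewrite big1 ?mul1r // => i _.
    by rewrite indicE mem_set //; exact: H.
  rewrite notin_setE => H.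
  have [i Hi] : exists i, ~ B i (X i w).
    by apply: contrapT => H'; apply: H => i _; apply: contrapT => H''; apply: H'; exists i.
  by rewrite (bigD1 i) //= indicE memNset // !mul0r.
rewrite (iidX.2 (fun i x => \1_(B i) x * gauss_lr s (m i) x)); last 2 first.
- move=> i; apply: measurable_funM; last exact: measurable_gauss_lr.
  by apply: measurable_indic.
- by move=> i x; rewrite mulr_ge0 ?gauss_lr_ge0.
apply: eq_bigr => i _; rewrite -integral_gauss_lr // [RHS]integral_mkcond.
apply: eq_integral => x _; rewrite patchE indicE.
by case: (x \in B i); rewrite ?mul1r ?mul0r.
Qed.

Lemma integral_product_lr (m : I -> R) : (\int[P]_w (product_lr s X m w)%:E = 1)%E.
Proof.
rewrite (_ : [set: Omega] = \bigcap_(i in [set: I]) X i @^-1` [set: R]).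
  rewrite (@integral_product_lr_cylinder m (fun=> setT)) // big1 // => i _.
  exact: probability_setT.
by apply/seteqP; split=> w // _ i.
Qed.

(** The product of two likelihood ratios is, up to a constant factor, the
    likelihood ratio for the sum of the shifts, which has mean 1. *)
Lemma integral_product_lrM (m m' : I -> R) :
  (\int[P]_w (product_lr s X m w * product_lr s X m' w)%:E =
   (expR (\sum_i m i * m' i / s ^+ 2))%:E)%E.
Proof.
rewrite (_ : (fun w => (product_lr s X m w * product_lr s X m' w)%:E) =
  (fun w => (expR (\sum_i m i * m' i / s ^+ 2))%:E * (product_lr s X (m \+ m') w)%:E)%E).
  rewrite ge0_integralZl //.
  - by rewrite integral_product_lr mule1.
  - by apply/measurable_EFinP; exact: measurable_product_lr.
  - by move=> w _; rewrite lee_fin product_lr_ge0.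
apply/funext => w; rewrite -EFinM; congr (_%:E).
rewrite /product_lr -big_split /= expR_sum -big_split /=.
by apply: eq_bigr => i _; exact: gauss_lrM.
Qed.

(** A density that is a product over the coordinates acts on each coordinate
    separately, so it preserves independence and only shifts the means. *)
Lemma tilted_probability (m : I -> R) : exists Pm : probability Omega R,
  [/\ forall A, Pm A = (\int[P]_(w in A) (product_lr s X m w)%:E)%E,
      forall B : I -> set R, (forall i, measurable (B i)) ->
        Pm (\bigcap_(i in [set: I]) X i @^-1` B i) =
        (\prod_i normal_prob (m i) s (B i))%E
    & forall i (B : set R), measurable B ->
        Pm (X i @^-1` B) = normal_prob (m i) s B].
Proof.
have [nu nuE] := density_measure P (measurable_product_lr m) (product_lr_ge0 m).
have nu1 : nu setT = 1%E by rewrite nuE integral_product_lr.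
pose Pm : probability Omega R := mnormalize nu P.
have PmE A : Pm A = (\int[P]_(w in A) (product_lr s X m w)%:E)%E.
  by rewrite /Pm /= /mnormalize nu1 onee_eq0 /= invr1 mule1 nuE.
exists Pm; split=> // [B mB|i B mB]; first by rewrite PmE integral_product_lr_cylinder.
pose B' j := if j == i then B else setT.
have mB' j : measurable (B' j) by rewrite /B'; case: ifP.
have -> : X i @^-1` B = \bigcap_(j in [set: I]) X j @^-1` B' j.
  apply/seteqP; split=> w /= => [Bw j _|/(_ i Logic.I)]; rewrite /B' ?eqxx //.
  by case: eqP => // ->.
rewrite PmE integral_product_lr_cylinder // (bigD1 i) //= /B' eqxx big1 ?mule1 // => j ji.
by rewrite (negPf ji) probability_setT.
Qed.

End iid_normal_theory.

(** * Testing against a mixture *)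

(** The set [A] is the event where the test decides for the mixture, [a] its
    error of first kind and [b j] that of second kind at [j]; both sides are
    multiplied by the square of the number of hypotheses to avoid divisions.
    With [S] the sum of the densities and [M] their number, the proof
    integrates the pointwise bound
    [2 M S <= M^2 1_A + M S 1_(~A) + S^2 + M^2 / 4]. *)
Lemma mixture_testing (R : realType) (dd : measure_display)
    (Omega : measurableType dd) (P : probability Omega R) (J : finType)
    (f : J -> Omega -> R) (A : set Omega) (a : R) (b : J -> R) :
  (forall j, measurable_fun [set: Omega] (f j)) -> (forall j w, 0 <= f j w) ->
  (forall j, \int[P]_w (f j w)%:E = 1)%E ->
  (\sum_j \sum_j' \int[P]_w (f j w * f j' w)%:E <= (5 / 4 * #|J|%:R ^+ 2)%:E)%E ->
  measurable A -> P A = a%:E ->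
  (forall j, \int[P]_(w in ~` A) (f j w)%:E = (b j)%:E)%E ->
  #|J|%:R ^+ 2 / 2 <= #|J|%:R ^+ 2 * a + #|J|%:R * \sum_j b j.
Proof.
move=> mf f0 f1 f2 mA Pa Pb; set M : R := #|J|%:R.
have M0 : 0 <= M by [].
pose S w := \sum_j f j w.
have S0 w : 0 <= S w by apply: sumr_ge0.
have mS : measurable_fun [set: Omega] S by apply: measurable_sum.
have mA1 : measurable_fun [set: Omega] (\1_A : Omega -> R) by exact: measurable_indic.
have mA2 : measurable_fun [set: Omega] (\1_(~` A) : Omega -> R).
  by apply: measurable_indic; exact: measurableC.
have pt w : (2 * M) * S w <= M ^+ 2 * \1_A w + M * (\1_(~` A) w * S w) + S w ^+ 2 + M ^+ 2 / 4.
  have S0' := S0 w.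
  (* the difference of the two sides is (S - M)^2 + M^2 / 4 on A
     and (S - M / 2)^2 off A *)
  have [Aw|nAw] := pselect (A w).
    rewrite !indicE mem_set // memNset; last by move=> /(_ Aw).
    rewrite mul0r mulr0 mulr1 addr0.
    by have := sqr_ge0 (S w - M); have := sqr_ge0 M; rewrite !expr2; nra.
  rewrite !indicE memNset // mem_set // mul1r mulr0 add0r.
  have := sqr_ge0 (S w - M / 2); rewrite !expr2; nra.
have IS : (\int[P]_w (S w)%:E = M%:E)%E.
  under eq_integral do rewrite -sumEFin.
  rewrite ge0_integral_sum //.
  - under eq_bigr do rewrite f1.
    by rewrite sumEFin sumr_const.
  - by move=> j; apply/measurable_EFinP.
  - by move=> j w _; rewrite lee_fin.
have IA : (\int[P]_w (\1_A w)%:E = a%:E)%E by rewrite integral_indic // setIT.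
have IB : (\int[P]_w (\1_(~` A) w * S w)%:E = (\sum_j b j)%:E)%E.
  transitivity (\sum_j \int[P]_w (\1_(~` A) w * f j w)%:E)%E.
    rewrite -ge0_integral_sum //.
    - by apply: eq_integral => w _; rewrite sumEFin mulr_sumr.
    - by move=> j; apply/measurable_EFinP; exact: measurable_funM.
    - by move=> j w _; rewrite lee_fin mulr_ge0.
  rewrite -sumEFin; apply: eq_bigr => j _; rewrite -Pb [RHS]integral_mkcond.
  apply: eq_integral => w _; rewrite patchE indicE.
  by case: (w \in _); rewrite ?mul1r ?mul0r.
have IS2 : (\int[P]_w (S w ^+ 2)%:E <= (5 / 4 * M ^+ 2)%:E)%E.
  apply: le_trans f2; rewrite le_eqVlt; apply/orP; left; apply/eqP.
  transitivity (\int[P]_w \sum_j \sum_j' (f j w * f j' w)%:E)%E.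
    apply: eq_integral => w _; rewrite expr2 /S mulr_suml -sumEFin.
    by apply: eq_bigr => j _; rewrite mulr_sumr -sumEFin.
  have mff j j' : measurable_fun [set: Omega] (fun w => (f j w * f j' w)%:E).
    by apply/measurable_EFinP; exact: measurable_funM.
  have ff0 j j' w : (0 <= (f j w * f j' w)%:E)%E by rewrite lee_fin mulr_ge0.
  rewrite ge0_integral_sum //.
  - by apply: eq_bigr => j _; rewrite ge0_integral_sum.
  - by move=> j; exact: emeasurable_sum.
  - by move=> j w _; apply: sume_ge0.
have I1 : (\int[P]_w ((2 * M) * S w)%:E = (2 * M ^+ 2)%:E)%E.
  under eq_integral do rewrite EFinM.
  rewrite ge0_integralZl ?IS // ?lee_fin ?mulr_ge0 //.
  - by rewrite -EFinM; congr (_%:E); ring.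
  - exact/measurable_EFinP.
  - by move=> w _; rewrite lee_fin.
have m1 : measurable_fun [set: Omega] (fun w => (M ^+ 2 * \1_A w)%:E).
  by apply/measurable_EFinP; exact: measurable_funM.
have m2' : measurable_fun [set: Omega] (fun w => \1_(~` A) w * S w).
  exact: measurable_funM.
have m2 : measurable_fun [set: Omega] (fun w => (M * (\1_(~` A) w * S w))%:E).
  by apply/measurable_EFinP; exact: measurable_funM.
have m3 : measurable_fun [set: Omega] (fun w => (S w ^+ 2)%:E).
  by apply/measurable_EFinP; exact: measurable_funX.
have p1 w : (0 <= (M ^+ 2 * \1_A w)%:E)%E by rewrite lee_fin mulr_ge0 // sqr_ge0.
have p2 w : (0 <= (M * (\1_(~` A) w * S w))%:E)%E by rewrite lee_fin !mulr_ge0.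
have p3 w : (0 <= (S w ^+ 2)%:E)%E by rewrite lee_fin sqr_ge0.
have p4 : (0 <= (M ^+ 2 / 4)%:E)%E by rewrite lee_fin divr_ge0 // sqr_ge0.
suff : ((2 * M ^+ 2)%:E <= (M ^+ 2 * a + M * (\sum_j b j) + 5 / 4 * M ^+ 2 + M ^+ 2 / 4)%:E)%E.
  by rewrite lee_fin; lra.
rewrite -I1.
apply: (@le_trans _ _ (\int[P]_w ((M ^+ 2 * \1_A w)%:E + (M * (\1_(~` A) w * S w))%:E
    + (S w ^+ 2)%:E + (M ^+ 2 / 4)%:E))%E).
  apply: ge0_le_integral => //.
  - by move=> w _; rewrite lee_fin !mulr_ge0.
  - by apply/measurable_EFinP; exact: measurable_funM.
  - by do 3 apply: emeasurable_funD => //.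
  - by move=> w _; rewrite -!EFinD lee_fin pt.
rewrite ge0_integralD //; last 2 first.
  - by move=> w _; rewrite !adde_ge0.
  - by do 2 apply: emeasurable_funD => //.
rewrite ge0_integralD //; last 2 first.
  - by move=> w _; rewrite !adde_ge0.
  - by apply: emeasurable_funD.
have I4 : (\int[P]_w (M ^+ 2 / 4)%:E = (M ^+ 2 / 4)%:E)%E.
  by rewrite integral_cst // [X in (_ * X)%E](@probability_setT _ _ _ P) mule1.
rewrite I4 ge0_integralD //.
rewrite !EFinD; apply: leeD => //; apply: leeD => //.
under eq_integral do rewrite EFinM.
rewrite ge0_integralZl ?lee_fin ?sqr_ge0 //; last exact/measurable_EFinP.
under [X in (_ + X)%E]eq_integral do rewrite EFinM.
rewrite [X in (_ + X)%E]ge0_integralZl ?lee_fin //; last 2 first.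
  - exact/measurable_EFinP.
  - by move=> w _; rewrite lee_fin mulr_ge0.
by rewrite IA IB -!EFinM.
Qed.

(** * Realising the model on one space *)

(** One function of the basic variables for all hypotheses, so that an estimator
    notices only the change of measure. *)
Definition common_obs (R : realType) (d n : nat) (p : 'I_d -> nat)
    (x : forall k : 'I_d, 'I_(p k) -> R) (g : 'rV[R]_d -> R) (Omega : Type)
    (X : 'I_n + obs_index n p -> Omega -> R) (w : Omega) : obs_index n p -> R :=
  fun q => X (inl q.1) w * g (design_point x q.2) + X (inr q) w.

(** A process with paths [c * g] and a Gaussian factor [c] then has a Hoelder norm
    dominated by a square integrable variable. *)
Definition holder_ray (R : realType) (d : nat) (b G : R) (g : 'rV[R]_d -> R) : Prop :=
  forall c : R, Cm_cube (strict_floor b) (fun t => c * g t) /\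
    (holder_norm b (fun t => c * g t)%R <= (`|c| * G)%:E)%E.

(** The mean shifts of a hypothesis: [th] for the variables of the curves and
    [e] for those of the single errors. *)
Definition source_shift (R : realType) (d n : nat) (p : 'I_d -> nat) (th : R)
    (e : obs_index n p -> R) (a : 'I_n + obs_index n p) : R :=
  match a with inl _ => th | inr q => e q end.

(** The probability [Pm] gives the variable of each source its shifted mean.
    Removing the shifts from the sources and putting them into the mean
    function leaves the observations unchanged, and yields a realisation of the
    model. *)
Lemma risk_of_shift (R : realType) (d : nat) (al be L CZ s V G : R)
    (n : nat) (p : 'I_d -> nat) (x : forall k : 'I_d, 'I_(p k) -> R)
    (k : 'I_d -> nat) (rate : R) (T : (obs_index n p -> R) -> 'rV[R]_d -> R)
    (dd : measure_display) (Omega : measurableType dd) (Pm : probability Omega R)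
    (X : 'I_n + obs_index n p -> Omega -> R)
    (g mu : 'rV[R]_d -> R) (th : R) (e : obs_index n p -> R) :
  s != 0 -> (forall a, measurable_fun [set: Omega] (X a)) ->
  (forall B : 'I_n + obs_index n p -> set R, (forall a, measurable (B a)) ->
     Pm (\bigcap_(a in [set: 'I_n + obs_index n p]) X a @^-1` B a) =
     (\prod_a normal_prob (source_shift th e a) s (B a))%E) ->
  (forall a (B : set R), measurable B ->
     Pm (X a @^-1` B) = normal_prob (source_shift th e a) s B) ->
  (\int[normal_prob 0 s]_z (z ^+ 2)%:E <= V%:E)%E -> V * G ^+ 2 <= CZ ->
  holder_ray be G g -> holder_class al L mu ->
  (forall q : obs_index n p, mu (design_point x q.2) =
     th * g (design_point x q.2) + e q) ->
  risks al be L CZ s x k rate T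
    (\int[Pm]_w (rate%:E * sup_norm (fun t => (T (common_obs x g X w) t - mderiv k mu t)%R)))%E.
Proof.
move=> s0 mX indX lawX HV VG Hg Hmu mu_obs.
have cg c : {within cube R d, continuous (fun t => c * g t)}.
  by have [[H _ _] _] := Hg c.
exists mu => //.
(* the process of the model is the same under all hypotheses *)
exists _, (measurableTypeR R), (normal_prob 0 s), (fun z t => z * g t).
have mid : measurable_fun [set: measurableTypeR R] (fun z : R => z) by [].
have idm c : measurable_fun [set: measurableTypeR R] (fun z : R => z * c).
  by apply: measurable_funM.
split.
- split.
  + by move=> t _; exact: idm.
  + by move=> z; have [] := Hg z.
  + have mM : measurable_fun [set: measurableTypeR R] (fun z : R => `|z| * G).
      by apply: measurable_funM => //; exact: measurableT_comp.
    pose M : {RV (normal_prob 0 s) >-> R} :=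
      HB.pack (fun z : measurableTypeR R => `|z| * G : R) (isMeasurableFun.Build _ _ _ _ _ mM).
    exists M; split.
      by apply: aeW => z; have [_] := Hg z.
    rewrite unlock /M /=.
    under eq_integral do rewrite exprMn real_normK ?num_real // EFinM.
    rewrite ge0_integralZr ?lee_fin ?sqr_ge0 //.
    * apply: (@le_trans _ _ (V%:E * (G ^+ 2)%:E)%E).
        by apply: lee_wpmul2r => //; rewrite lee_fin sqr_ge0.
      by rewrite -EFinM lee_fin.
    * by apply/measurable_EFinP; exact: measurable_funX.
    * by move=> z _; rewrite lee_fin sqr_ge0.
- move=> t _; split.
    under eq_fun do rewrite mulrC EFinM.
    by apply: integrableZl => //; exact: normal_integrable.
  under eq_integral do rewrite mulrC EFinM.
  rewrite integralZl //; last exact: normal_integrable.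
  by rewrite normal_mean // mule0.
- by move=> z; exact: cg.
have meps q : measurable_fun [set: Omega] (fun w => X (inr q) w - e q).
  by apply: measurable_funB => //; exact: mX.
pose Zs (i : 'I_n) (w : Omega) (t : 'rV[R]_d) := (X (inl i) w - th) * g t.
pose eps (q : obs_index n p) : {RV Pm >-> R} :=
  HB.pack (fun w : Omega => X (inr q) w - e q) (isMeasurableFun.Build _ _ _ _ _ (meps q)).
exists dd, Omega, Pm, Zs, eps.
have msub c : measurable_fun [set: R] (fun z : R => z - c) by exact: measurable_funB.
have mZ (c : R) A : cylinder_sigma (cube R d) A ->
    measurable ((fun z t => (z - c) * g t) @^-1` A).
  apply: (@cylinder_preimage R _ (measurableTypeR R)) => t _.
  by apply: measurable_funM; [exact: msub|exact: measurable_cst].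
split; last first.
  apply: eq_integral => w _; congr (_ * sup_norm _)%E; apply/funext => t.
  congr (T _ t - _); apply/funext => q; rewrite /common_obs /fd_obs /Zs /=.
  by rewrite mu_obs; ring.
split.
- move=> i; split=> [t _|w]; last exact: cg.
  by apply: measurable_funM => //; apply: measurable_funB => //; exact: mX.
- move=> i A cA; have mA0 := mZ 0 A cA.
  have E : (fun z t => z * g t) @^-1` A = (fun z t => (z - 0) * g t) @^-1` A.
    by apply/seteqP; split=> z /=; rewrite subr0.
  rewrite E.
  have -> : Zs i @^-1` A = X (inl i) @^-1` ((fun z : R => z - th) @^-1`
      ((fun z t => (z - 0) * g t) @^-1` A)).
    by apply/seteqP; split=> w /=; rewrite /Zs /= subr0.
  rewrite lawX ?normal_prob_shift //.
  by rewrite -[X in measurable X]setTI; exact: msub.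
- move=> q B mB.
  have -> : eps q @^-1` B = X (inr q) @^-1` ((fun z : R => z - e q) @^-1` B) by [].
  rewrite lawX ?normal_prob_shift //.
  by rewrite -[X in measurable X]setTI; exact: msub.
- move=> E HE.
  have /choice[B HB] : forall a, exists B : set R, measurable B /\ E a = X a @^-1` B.
    case=> [i|q].
      have [A cA <-] := HE (inl i).
      by exists ((fun z t => (z - th) * g t) @^-1` A); split=> //; exact: mZ.
    have [A mA <-] := HE (inr q).
    exists ((fun z : R => z - e q) @^-1` A); split=> //.
    by rewrite -[X in measurable X]setTI; exact: msub.
  transitivity (Pm (\bigcap_(a in [set: 'I_n + obs_index n p]) X a @^-1` B a)).
    by congr (Pm _); apply: eq_bigcapr => a _; have [] := HB a.
  rewrite indX; last by move=> a; have [] := HB a.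
  by apply: eq_bigr => a _; have [mB ->] := HB a; rewrite lawX.
Qed.

(** The loss is a supremum over uncountably many points and may fail to be
    measurable; the integral of a nonnegative function is a supremum over the
    simple functions below it, and as such monotone. *)
Lemma ge0_le_integral_nonmeasurable (R : realType) (dd : measure_display)
    (Omega : measurableType dd) (P : {measure set Omega -> \bar R})
    (f1 f2 : Omega -> \bar R) :
  (forall w, 0 <= f1 w)%E -> (forall w, f1 w <= f2 w)%E ->
  (\int[P]_w f1 w <= \int[P]_w f2 w)%E.
Proof.
move=> f10 f12.
have f20 w : (0 <= f2 w)%E by exact: le_trans (f12 w).
rewrite !ge0_integralTE //; apply: ereal_sup_le => _ [h /= hf <-].
by exists h => //= w; exact: le_trans (f12 w).
Qed.

Lemma sup_norm_ge (R : realType) (d : nat) (f : 'rV[R]_d -> R) (t : 'rV[R]_d) :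
  cube R d t -> ((`|f t|)%:E <= sup_norm f)%E.
Proof. by move=> ct; apply: ereal_sup_ubound; exists t. Qed.

(** Any estimator [T] yields a test: it rejects the zero mean when the estimate
    at some point [t j] exceeds [delta / 2]. Where the test errs, the loss is
    at least [delta / 2] under the hypothesis in force, so the risk is bounded
    below by the errors of the test. The hypotheses enter only through the
    second moment of the mixture of their likelihood ratios. *)
Lemma minimax_ge (R : realType) (d : nat) (al be L CZ s V G : R)
    (n : nat) (p : 'I_d -> nat) (x : forall k : 'I_d, 'I_(p k) -> R)
    (k : 'I_d -> nat) (rate delta : R) (J : finType) (g : 'rV[R]_d -> R)
    (th : J -> R) (e : J -> obs_index n p -> R) (mu : J -> 'rV[R]_d -> R)
    (t : J -> 'rV[R]_d) :
  s != 0 -> (\int[normal_prob 0 s]_z (z ^+ 2)%:E <= V%:E)%E ->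
  V * G ^+ 2 <= CZ -> holder_ray be G g ->
  0 <= rate -> 0 <= delta -> (0 < #|J|)%N ->
  holder_class al L (fun _ : 'rV[R]_d => 0) ->
  (forall u, cube R d u -> mderiv k (fun _ : 'rV[R]_d => (0 : R)) u = 0) ->
  (forall j, holder_class al L (mu j)) ->
  (forall j (q : obs_index n p), mu j (design_point x q.2) =
     th j * g (design_point x q.2) + e j q) ->
  (forall j, cube R d (t j)) -> (forall j, delta <= `|mderiv k (mu j) (t j)|) ->
  \sum_j \sum_j' expR (\sum_a source_shift (th j) (e j) a * source_shift (th j') (e j') a / s ^+ 2)
    <= 5 / 4 * #|J|%:R ^+ 2 ->
  ((rate * delta / 8)%:E <= minimax_risk al be L CZ s n x k rate)%E.
Proof.
move=> s0 HV VG Hg rate0 delta0 J0 H0 D0 Hmu mu_obs ct Ht Hsum.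
apply: le_ereal_inf_tmp => _ [T estT <-].
have [dd [Om [P [X iidX]]]] := iid_family (normal_prob 0 s) ('I_n + obs_index n p)%type.
set risk := ereal_sup _.
pose loss m w := (rate%:E * sup_norm (fun u => T (common_obs x g X w) u - mderiv k m u)%R)%E.
pose A := [set w | exists j, delta / 2 <= `|T (common_obs x g X w) (t j)|].
have mobs q : measurable_fun [set: Om] (fun w => common_obs x g X w q).
  apply: measurable_funD; last exact: iidX.1.
  by apply: measurable_funM => //; exact: iidX.1.
have mA : measurable A.
  have -> : A = \bigcup_(j in [set: J]) (common_obs x g X @^-1`
      ((fun y => T y (t j)) @^-1` [set z : R | delta / 2 <= `|z|])).
    by apply/seteqP; split=> w [j] /=; [exists j|move=> _; exists j].
  apply: fin_bigcup_measurable; first exact: finite_finset.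
  move=> j _; apply: (@cylinder_preimage R _ _ _ [set: obs_index n p]) => //.
  apply: estT => //.
  have -> : [set z : R | delta / 2 <= `|z|] =
      (fun z : R => `|z|) @^-1` `[delta / 2, +oo[%classic.
    by apply/seteqP; split=> z /=; rewrite in_itv /= andbT.
  have mn : measurable_fun [set: R] (fun z : R => `|z|) by exact: measurableT_comp.
  by have := mn measurableT _ (measurable_itv `[delta / 2, +oo[); rewrite setTI.
pose c := rate * (delta / 2).
have c0 : 0 <= c by rewrite mulr_ge0 // divr_ge0.
have lower (Pm : probability Om R) (m : 'rV[R]_d -> R) (B : set Om) :
    measurable B -> risks al be L CZ s x k rate T (\int[Pm]_w loss m w)%E ->
    (forall w, B w -> exists2 u, cube R d u &
       delta / 2 <= `|T (common_obs x g X w) u - mderiv k m u|) ->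
    (c%:E * Pm B <= risk)%E.
  move=> mB rB HB; apply: le_trans (ereal_sup_ubound rB).
  have -> : (c%:E * Pm B = \int[Pm]_w (c%:E * (\1_B w)%:E))%E.
    rewrite ge0_integralZl ?lee_fin //; first by rewrite integral_indic // setIT.
    by apply/measurable_EFinP; exact: measurable_indic.
  apply: ge0_le_integral_nonmeasurable => w; first by rewrite mule_ge0 ?lee_fin.
  rewrite indicE; case: (boolP (w \in B)) => [|_]; last first.
    rewrite mule0 mule_ge0 ?lee_fin //.
    by apply: le_trans (sup_norm_ge _ (ct (enum_val (Ordinal J0)))); rewrite lee_fin.
  rewrite inE mule1 => /HB [u cu Hu].
  rewrite EFinM; apply: lee_pmul; rewrite ?lee_fin ?divr_ge0 //.
  by apply: le_trans (sup_norm_ge _ cu); rewrite lee_fin.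
have [P0 [P0E P0ind P0law]] :=
  tilted_probability s0 iidX (source_shift 0 (fun _ : obs_index n p => 0)).
(* the zero mean is the hypothesis without shifts *)
have source_shift0 a : @source_shift R d n p 0 (fun=> 0) a = 0 by case: a.
have PA : P0 A = P A.
  rewrite P0E -[RHS]mul1e -[RHS]integral_cst //; apply: eq_integral => w _.
  rewrite /product_lr big1 // => a _.
  by rewrite source_shift0 /gauss_lr expr0n /= !mul0r subrr expR0.
have R0 : (c%:E * P A <= risk)%E.
  rewrite -PA; apply: (@lower P0 (fun=> 0)) => //.
    have Q := @risk_of_shift R d al be L CZ s V G n p x k rate T _ _ P0 X g
      (fun=> 0) 0 (fun=> 0) s0 iidX.1 P0ind P0law HV VG Hg H0.
    apply: Q => q.
    by rewrite mul0r add0r.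
  by move=> w [j Hj]; exists (t j) => //; rewrite D0 // subr0.
have Rj j : (c%:E * \int[P]_(w in ~` A)
    (product_lr s X (source_shift (th j) (e j)) w)%:E <= risk)%E.
  have [Pj [PjE Pjind Pjlaw]] := tilted_probability s0 iidX (source_shift (th j) (e j)).
  rewrite -PjE; apply: (@lower Pj (mu j)); first exact: measurableC.
    exact: (@risk_of_shift R d al be L CZ s V G n p x k rate T _ _ Pj X g
      (mu j) (th j) (e j) s0 iidX.1 Pjind Pjlaw HV VG Hg (Hmu j)) (mu_obs j).
  move=> w nA; exists (t j) => //.
  have HT : `|T (common_obs x g X w) (t j)| < delta / 2.
    by rewrite ltNge; apply/negP => H; apply: nA; exists j.
  rewrite distrC; apply: le_trans (lerB_dist _ _).
  by have := Ht j; lra.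
have risk0 : (0 <= risk)%E by apply: le_trans R0; rewrite mule_ge0 ?lee_fin.
clear lower; move: R0 Rj risk0; case: risk => [r| |] // R0 Rj _; last by rewrite leey.
have fP : P A \is a fin_num by exact: fin_num_measure.
have int1 j := integral_product_lr s0 iidX (source_shift (th j) (e j)).
have bfin j : (\int[P]_(w in ~` A)
    (product_lr s X (source_shift (th j) (e j)) w)%:E)%E \is a fin_num.
  rewrite ge0_fin_numE; last by apply: integral_ge0 => w _; rewrite lee_fin product_lr_ge0.
  apply: (@le_lt_trans _ _ 1%E); last exact: ltry.
  rewrite -(int1 j); apply: ge0_subset_integral => //.
  - exact: measurableC.
  - by apply/measurable_EFinP; exact: measurable_product_lr iidX _.
  - by move=> w _; rewrite lee_fin product_lr_ge0.
pose a := fine (P A).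
pose b j := fine (\int[P]_(w in ~` A) (product_lr s X (source_shift (th j) (e j)) w)%:E)%E.
have HX := @mixture_testing R _ _ P J (fun j => product_lr s X (source_shift (th j) (e j))) A a b.
have {}HX : #|J|%:R ^+ 2 / 2 <= #|J|%:R ^+ 2 * a + #|J|%:R * \sum_j b j.
  apply: HX => //.
  - by move=> j; exact: measurable_product_lr iidX _.
  - by move=> j w; exact: product_lr_ge0.
  - apply: le_trans (_ : (\sum_j \sum_j' (expR (\sum_a source_shift (th j) (e j) a *
      source_shift (th j') (e j') a / s ^+ 2))%:E <= _)%E).
      by apply: lee_sum => j _; apply: lee_sum => j' _; rewrite integral_product_lrM.
    under eq_bigr do rewrite sumEFin.
    by rewrite sumEFin lee_fin.
  - by rewrite /a fineK.
  - by move=> j; rewrite /b fineK.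
have ra : c * a <= r by rewrite -lee_fin EFinM /a fineK.
have rb j : c * b j <= r by rewrite -lee_fin EFinM /b fineK // Rj.
have rsb : c * (\sum_j b j) <= #|J|%:R * r.
  rewrite mulr_sumr mulr_natl -sumr_const; exact: ler_sum.
have M0 : 0 < #|J|%:R :> R by rewrite ltr0n.
have M20 : 0 < #|J|%:R ^+ 2 :> R by rewrite exprn_gt0.
rewrite lee_fin.
move: HX rsb M0 M20; set M : R := #|J|%:R; set Sb := \sum_j b j => HX rsb M0 M20.
have h1 := ler_wpM2l c0 HX.
have h2 := ler_wpM2l (ltW M20) ra.
have h3 := ler_wpM2l (ltW M0) rsb.
have h4 : M ^+ 2 * (c / 2) <= M ^+ 2 * (2 * r) by move: h1 h2 h3; rewrite !expr2; nra.
by move: h4; rewrite ler_pM2l // /c; lra.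
Qed.

(** * Signals hidden between the design points *)

(** Pigeonhole principle: [q] points cannot meet all of [q.+1] disjoint
    intervals. *)
Lemma free_gap (R : realType) (q : nat) (y : 'I_q -> R) :
  exists i : 'I_q.+1, forall l,
    ~~ (i%:R * q.+1%:R^-1 < y l < i%:R * q.+1%:R^-1 + q.+1%:R^-1).
Proof.
apply: contrapT => H.
have /choice[f Hf] : forall i : 'I_q.+1, exists l : 'I_q,
    i%:R * q.+1%:R^-1 < y l < i%:R * q.+1%:R^-1 + q.+1%:R^-1.
  move=> i; apply: contrapT => H'; apply: H; exists i => l; apply/negP => H''.
  by apply: H'; exists l.
have N0 : 0 < q.+1%:R :> R by rewrite ltr0n.
have cell (i : 'I_q.+1) : i%:R < y (f i) * q.+1%:R < i.+1%:R.
  have /andP[h1 h2] := Hf i; rewrite -ltr_pdivrMr // h1 /=.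
  by rewrite -ltr_pdivlMr // (lt_le_trans h2) // -[i.+1%:R]natr1 mulrDl mul1r.
have inj_f : injective f.
  move=> i j fij; apply/val_inj/eqP; rewrite /= eqn_leq.
  have /andP[h1 h2] := cell i; have /andP[h3 h4] := cell j.
  rewrite -ltnS -(ltr_nat R) (lt_trans h1) /=; last by rewrite fij.
  by rewrite -ltnS -(ltr_nat R) (lt_trans h3) //= -fij.
by have := leq_card f inj_f; rewrite !card_ord ltnn.
Qed.

Lemma pmin_attained (d : nat) (p : 'I_d -> nat) : (0 < d)%N ->
  exists k, p k = pmin p.
Proof.
move=> d0.
rewrite /pmin; elim/big_ind : _ => [|u v [k <-] [l <-]|k _]; last by exists k.
  have [|k Hk] := @bigop.eq_bigmax 'I_d p; first by rewrite card_ord.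
  by exists k.
by rewrite /minn; case: ifP; [exists k|exists l].
Qed.

Lemma holder_ray0 (R : realType) (d : nat) (al be : R) s F C D kap tau :
  @bump_system R d al be s F C D kap tau ->
  holder_ray be 0 (fun _ : 'rV[R]_d => (0 : R)).
Proof.
move=> H c.
have -> : (fun _ : 'rV[R]_d => c * 0) = F 0 1 (fun=> 0).
  by apply/funext => u; have := bs_scale H 0 0 1 (fun=> 0) u; rewrite !mul0r mulr0.
split; first exact: bs_Cm_be H _ _ _.
have h01 : 0 < (1 : R) <= 1 by rewrite ltr01 lexx.
by have := bs_holder_be H 0 (fun=> 0) h01; rewrite normr0 !mul0r mulr0.
Qed.

Lemma holder_class0 (R : realType) (d : nat) (al be L : R) s F C D kap tau :
  @bump_system R d al be s F C D kap tau -> 0 < L ->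
  holder_class al L (fun _ : 'rV[R]_d => (0 : R)).
Proof.
move=> H L0.
have -> : (fun _ : 'rV[R]_d => 0) = F 0 1 (fun=> 0).
  by apply/funext => u; have := bs_scale H 0 0 1 (fun=> 0) u; rewrite !mul0r.
split; first exact: bs_Cm_al H _ _ _.
have h01 : 0 < (1 : R) <= 1 by rewrite ltr01 lexx.
apply: (le_trans (bs_holder_al H 0 (fun=> 0) h01)).
by rewrite normr0 !mul0r lee_fin ltW.
Qed.

Lemma holder_class_bump (R : realType) (d : nat) (al be L : R) s F C D kap tau
    (A h : R) (a : 'I_d -> R) :
  @bump_system R d al be s F C D kap tau -> 0 < h <= 1 ->
  `|A| * h `^ (- al) * C <= L -> holder_class al L (F A h a).
Proof.
move=> H h01 AL; split; first exact: bs_Cm_al H _ _ _.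
by apply: (le_trans (bs_holder_al H A a h01)); rewrite lee_fin.
Qed.

(** The bump lies over an interval of the coordinate [k0] that is free of
    design coordinates. It vanishes at all design points, all shifts are zero,
    and the observations do not distinguish it from the zero function. *)
Lemma between_points_bound (R : realType) (d : nat) (al be L CZ s : R)
    (k : 'I_d -> nat) F C D kap tau (n : nat) (p : 'I_d -> nat)
    (x : forall k : 'I_d, 'I_(p k) -> R) (rate : R) :
  (0 < d)%N -> @bump_system R d al be k F C D kap tau -> 0 < L -> 0 < CZ ->
  s != 0 -> 0 <= rate ->
  ((rate * (L / C * kap * (pmin p).+1%:R^-1 `^ (al - (msize k)%:R)) / 8)%:E <=
    minimax_risk al be L CZ s n x k rate)%E.
Proof.
move=> d0 H L0 CZ0 s0 rate0.
have [k0 pk0] := pmin_attained p d0.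
rewrite -pk0; set q := p k0; pose h : R := q.+1%:R^-1.
have h0 : 0 < h by rewrite invr_gt0 ltr0n.
have h01 : 0 < h <= 1 by rewrite h0 invf_le1 ?ltr0n // ler1n.
have [i Hi] := free_gap (x k0).
rewrite -/q -/h in i Hi.
pose a (l : 'I_d) : R := if l == k0 then i%:R * h else 0.
have C0 := bs_C H.
pose A : R := L / C * h `^ al.
have A0 : 0 <= A by rewrite mulr_ge0 ?powR_ge0 // divr_ge0 // ltW.
have hal : h `^ al * h `^ (- al) = 1.
  by rewrite -powRD ?subrr ?powRr0 // (gt_eqF h0) implybT.
pose t : 'rV[R]_d := \row_l (a l + h * tau l).
have [V V0 HV] := normal_second_moment s0.
have ct : cube R d t.
  move=> l; rewrite mxE /a; have /andP[t0 t1] := bs_tau H l.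
  have ht0 : 0 <= h * tau l by rewrite mulr_ge0 // ltW.
  have ht1 : h * tau l <= h by rewrite ler_piMr // ltW.
  have hle1 : h <= 1 by case/andP: h01.
  case: eqP => _; last by rewrite add0r ht0 (le_trans ht1).
  rewrite addr_ge0 // ?mulr_ge0 ?(ltW h0) //=.
  apply: (le_trans (lerD (lexx _) ht1)).
  rewrite -{2}[h]mul1r -mulrDl natr1 /h ler_pdivrMr ?ltr0n // mul1r ler_nat.
  exact: ltn_ord.
have := @minimax_ge R d al be L CZ s V 0 n p x k rate
  (L / C * kap * h `^ (al - (msize k)%:R)) unit (fun=> 0) (fun=> 0)
  (fun _ _ => 0) (fun=> F A h a) (fun=> t).
apply => //.
- by rewrite expr0n /= mulr0 ltW.
- exact: holder_ray0 H.
- by rewrite !mulr_ge0 ?powR_ge0 ?invr_ge0 ?(ltW L0) ?(ltW C0) ?(ltW (bs_kap H)).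
- by rewrite card_unit.
- exact: holder_class0 H L0.
- exact: bs_mderiv0 H.
- move=> _; apply: (holder_class_bump _ H) => //.
  rewrite ger0_norm // /A -[_ * h `^ al * _]mulrA hal mulr1 divfK //.
  by rewrite gt_eqF.
- move=> _ z; rewrite mul0r addr0; apply: (@bs_support _ _ _ _ _ _ _ _ _ _ H _ _ _ _ k0) => //.
  by rewrite /a eqxx /design_point mxE.
- move=> _; rewrite (bs_mderiv H) //; last by move=> l; rewrite mxE.
  rewrite ger0_norm // /A powRD ?(gt_eqF h0) ?implybT //.
  by rewrite le_eqVlt; apply/orP; left; apply/eqP; ring.
- rewrite card_unit !big_const card_unit /= !addr0 big1.
    by rewrite expR0 expr1n; lra.
  by move=> [? _|? _] /=; rewrite mul0r mul0r.
Qed.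

(** * Signals hidden by the process *)

Lemma holder_ray_bump (R : realType) (d : nat) (al be G : R) s F C D kap tau
    (A h : R) (a : 'I_d -> R) :
  @bump_system R d al be s F C D kap tau -> 0 < h <= 1 ->
  `|A| * h `^ (- be) * C <= G -> holder_ray be G (F A h a).
Proof.
move=> H h01 AG c.
have -> : (fun u => c * F A h a u) = F (c * A) h a.
  by apply/funext => u; exact: bs_scale H _ _ _ _ _.
split; first exact: bs_Cm_be H _ _ _.
apply: (le_trans (bs_holder_be H (c * A) a h01)); rewrite lee_fin normrM.
by rewrite -!mulrA ler_wpM2l // mulrA.
Qed.

Lemma expR_le_inv (R : realType) (y : R) : y < 1 -> expR y <= (1 - y)^-1.
Proof.
move=> y1; rewrite -[expR y]invrK -expRN lef_pV2 ?posrE ?expR_gt0 ?subr_gt0 //.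
exact: expR_ge1Dx.
Qed.

(** With the shift [s / 4] times [n ^ (- 1/2)] in [n] Gaussian variables, the
    second moment of the likelihood ratio is [exp (1 / 16)], which is below
    5/4. *)
Lemma mean_shift_bound (R : realType) (d : nat) (al be L CZ s V G : R)
    (k : 'I_d -> nat) F C D kap tau (n : nat) (p : 'I_d -> nat)
    (x : forall k : 'I_d, 'I_(p k) -> R) (rate A h : R) :
  @bump_system R d al be k F C D kap tau -> 0 < L -> 0 < s ->
  (\int[normal_prob 0 s]_z (z ^+ 2)%:E <= V%:E)%E -> V * G ^+ 2 <= CZ ->
  0 <= rate -> (0 < n)%N -> 0 < h <= 1 -> 0 <= A ->
  A * h `^ (- be) * C <= G ->
  (s / 4 * n%:R `^ (- 2^-1) * A) * h `^ (- al) * C <= L ->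
  ((rate * (s / 4 * n%:R `^ (- 2^-1) * A * h `^ (- (msize k)%:R) * kap) / 8)%:E <=
    minimax_risk al be L CZ s n x k rate)%E.
Proof.
move=> H L0 s0 HV VG rate0 n0 h01 A0 AG AL.
have /andP[h0 h1] := h01.
pose th : R := s / 4 * n%:R `^ (- 2^-1).
have th0 : 0 <= th by rewrite mulr_ge0 ?powR_ge0 // divr_ge0 // ltW.
pose a (l : 'I_d) : R := 0.
pose t : 'rV[R]_d := \row_l (h * tau l).
have ct : cube R d t.
  move=> l; rewrite mxE; have /andP[t0 t1] := bs_tau H l.
  by rewrite mulr_ge0 ?(ltW t0) ?(ltW h0) //= mulr_ile1 ?(ltW t0) ?(ltW h0) ?(ltW t1).
have := @minimax_ge R d al be L CZ s V G n p x k rate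
  (th * A * h `^ (- (msize k)%:R) * kap) unit (F A h a) (fun=> th)
  (fun _ _ => 0) (fun=> F (th * A) h a) (fun=> t).
apply => //.
- by rewrite gt_eqF.
- by apply: (holder_ray_bump _ H) => //; rewrite ger0_norm.
- apply: mulr_ge0; last exact: ltW (bs_kap H).
  by apply: mulr_ge0; [exact: mulr_ge0|exact: powR_ge0].
- by rewrite card_unit.
- exact: holder_class0 H L0.
- exact: bs_mderiv0 H.
- by move=> _; apply: (holder_class_bump _ H) => //; rewrite ger0_norm //; exact: mulr_ge0.
- by move=> _ q; rewrite addr0 (bs_scale H).
- move=> _; rewrite (bs_mderiv H) //.
    by rewrite ger0_norm //; exact: mulr_ge0.
  by move=> l; rewrite mxE add0r.
- rewrite card_unit !big_const card_unit /= !addr0 big_sumType /=.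
  rewrite [X in _ + X]big1; last by move=> q _; rewrite mul0r mul0r.
  rewrite addr0 sumr_const card_ord expr1n mulr1.
  have -> : th * th / s ^+ 2 *+ n = 16^-1.
    have nn : n%:R `^ (- 2^-1) * n%:R `^ (- 2^-1) = n%:R^-1 :> R.
      rewrite -powRD; last by rewrite pnatr_eq0 -lt0n n0 implybT.
      by rewrite (_ : - 2^-1 + - 2^-1 = -1 :> R) ?powR_inv1 //; lra.
    have n0' : n%:R != 0 :> R by rewrite pnatr_eq0 -lt0n.
    rewrite /th -mulr_natr.
    transitivity ((n%:R `^ (- 2^-1) * n%:R `^ (- 2^-1)) * n%:R * (s / s) ^+ 2 / 16 : R).
      have -> : 16^-1 = 4^-1 * 4^-1 :> R by rewrite -invfM; congr (_^-1); ring.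
      by rewrite [s ^+ 2]expr2 invfM; ring.
    by rewrite nn mulVf // divff ?gt_eqF // expr1n !mul1r.
  apply: (le_trans (expR_le_inv _)); first by lra.
  by rewrite (_ : 1 - 16^-1 = 15 / 16 :> R) ?invf_div; lra.
Qed.

(** * Signals hidden by the errors *)

(** Open cells of the partition of the cube into [m ^ d] cubes; a bump of width
    [1 / m] vanishes on the faces. *)
Definition in_cell (R : realType) (d m : nat) (c : {ffun 'I_d -> 'I_m})
    (u : 'rV[R]_d) : bool :=
  [forall k, (c k)%:R * m%:R^-1 < u 0 k < (c k)%:R * m%:R^-1 + m%:R^-1].

Lemma in_cell_inj (R : realType) (d m : nat) (c c' : {ffun 'I_d -> 'I_m})
    (u : 'rV[R]_d) : in_cell c u -> in_cell c' u -> c = c'.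
Proof.
move=> /forallP Hc /forallP Hc'; apply/ffunP => k; apply/val_inj/eqP => /=.
have m0 : 0 < m%:R :> R by rewrite ltr0n (leq_trans _ (ltn_ord (c k))).
have cell (e : {ffun 'I_d -> 'I_m}) :
    (e k)%:R * m%:R^-1 < u 0 k < (e k)%:R * m%:R^-1 + m%:R^-1 ->
    (e k)%:R < u 0 k * m%:R < (e k).+1%:R.
  move=> /andP[h1 h2]; rewrite -ltr_pdivrMr // h1 /=.
  by rewrite -ltr_pdivlMr // (lt_le_trans h2) // -[_.+1%:R]natr1 mulrDl mul1r.
have /andP[h1 h2] := cell _ (Hc k); have /andP[h3 h4] := cell _ (Hc' k).
rewrite eqn_leq -ltnS -(ltr_nat R) (lt_trans h1) //=.
by rewrite -ltnS -(ltr_nat R) (lt_trans h3).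
Qed.

Definition cell_count (R : realType) (d m : nat) (p : 'I_d -> nat)
    (x : forall k : 'I_d, 'I_(p k) -> R) (c : {ffun 'I_d -> 'I_m}) : nat :=
  #|[set j : grid p | in_cell c (design_point x j)]%SET|.

Lemma card_grid (d : nat) (p : 'I_d -> nat) : #|{: grid p}| = pprod p.
Proof.
rewrite /grid card_dep_ffun /pprod foldrE big_map big_enum /=.
by apply: eq_bigr => k _; rewrite card_ord.
Qed.

Lemma sum_cell_count (R : realType) (d m : nat) (p : 'I_d -> nat)
    (x : forall k : 'I_d, 'I_(p k) -> R) :
  (\sum_(c : {ffun 'I_d -> 'I_m}) cell_count x c <= pprod p)%N.
Proof.
under eq_bigr do rewrite /cell_count -sum1dep_card big_mkcond /=.
rewrite exchange_big /= -card_grid -sum1_card; apply: leq_sum => j _.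
rewrite -big_mkcond /= sum1dep_card; apply/card_le1_eqP => c c'.
by rewrite !inE => cj c'j; exact: in_cell_inj c'j cj.
Qed.

(** If more than half of the cells contained more than twice the average number
    of design points, there would be too many design points. *)
Lemma many_light_cells (R : realType) (d m : nat) (p : 'I_d -> nat)
    (x : forall k : 'I_d, 'I_(p k) -> R) :
  (m ^ d <= 2 * #|[pred c : {ffun 'I_d -> 'I_m} |
      cell_count x c * m ^ d <= 2 * pprod p]|)%N.
Proof.
set light := [pred c : {ffun 'I_d -> 'I_m} | _].
have Htot : (#|light| + #|[predC light]| = m ^ d)%N.
  by rewrite cardC card_ffun !card_ord.
have Hheavy : (#|[predC light]| * (2 * pprod p).+1 <= m ^ d * pprod p)%N.
  rewrite -sum_nat_const; apply: (@leq_trans (\sum_(c in [predC light]) cell_count x c * m ^ d)).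
    by apply: leq_sum => c; rewrite !inE -ltnNge.
  apply: (@leq_trans (\sum_(c : {ffun 'I_d -> 'I_m}) cell_count x c * m ^ d)).
    by rewrite [leqRHS](bigID [in [predC light]]) /= leq_addr.
  by rewrite -big_distrl /= mulnC leq_mul2l sum_cell_count orbT.
nia.
Qed.

(** One hypothesis for each light cell. Bumps in different cells have disjoint
    supports, so their likelihood ratios are uncorrelated, and the second
    moment of the mixture exceeds 1 by at most [exp E] divided by the number of
    light cells, where [E] bounds the information in one cell. *)
Lemma light_cells_bound (R : realType) (d : nat) (al be L CZ s : R)
    (k : 'I_d -> nat) F C D kap tau (n m : nat) (p : 'I_d -> nat)
    (x : forall k : 'I_d, 'I_(p k) -> R) (rate A : R) :
  @bump_system R d al be k F C D kap tau -> 0 < L -> 0 < CZ -> s != 0 ->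
  0 <= rate -> (0 < m)%N -> 0 <= A -> A * m%:R^-1 `^ (- al) * C <= L ->
  expR (2 * (A * D) ^+ 2 / s ^+ 2 * (n%:R * (pprod p)%:R) / m%:R ^+ d) <=
    m%:R ^+ d / 8 ->
  ((rate * (A * m%:R^-1 `^ (- (msize k)%:R) * kap) / 8)%:E <=
    minimax_risk al be L CZ s n x k rate)%E.
Proof.
move=> H L0 CZ0 s0 rate0 m0 A0 AL.
set E := (X in expR X) => HE.
have m0' : 0 < m%:R :> R by rewrite ltr0n.
have md0 : 0 < m%:R ^+ d :> R by rewrite exprn_gt0.
pose h : R := m%:R^-1.
have h0 : 0 < h by rewrite invr_gt0.
have h01 : 0 < h <= 1 by rewrite h0 invf_le1 // ler1n.
have [V V0 HV] := normal_second_moment s0.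
pose J : finType := {c : {ffun 'I_d -> 'I_m} | (cell_count x c * m ^ d <= 2 * pprod p)%N}.
pose a (j : J) (l : 'I_d) : R := (val j l)%:R * h.
pose t (j : J) : 'rV[R]_d := \row_l (a j l + h * tau l).
pose e (j : J) (q : obs_index n p) := F A h (a j) (design_point x q.2).
have HJ : m%:R ^+ d <= 2 * #|J|%:R :> R.
  rewrite -natrX -natrM ler_nat card_sig; exact: many_light_cells.
have J0 : (0 < #|J|)%N.
  by rewrite -(ltr_nat R); move: HJ md0; nra.
have E0 : 0 <= E.
  rewrite /E; apply: divr_ge0; last exact: ltW.
  apply: mulr_ge0; last exact: mulr_ge0.
  by apply: divr_ge0; [apply: mulr_ge0 => //|]; exact: sqr_ge0.
have ct j : cube R d (t j).
  move=> l; rewrite mxE /a; have /andP[t0 t1] := bs_tau H l.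
  have ht0 : 0 <= h * tau l by rewrite mulr_ge0 // ltW.
  have ht1 : h * tau l <= h by rewrite ler_piMr // ltW.
  rewrite addr_ge0 // ?mulr_ge0 ?(ltW h0) //=.
  apply: (le_trans (lerD (lexx _) ht1)).
  rewrite -{2}[h]mul1r -mulrDl natr1 /h ler_pdivrMr ?ltr0n // mul1r ler_nat.
  exact: ltn_ord.
have esupp j q : ~~ in_cell (val j) (design_point x q.2) -> e j q = 0.
  rewrite negb_forall => /existsP[l Hl].
  exact: (@bs_support _ _ _ _ _ _ _ _ _ _ H _ _ _ _ l).
have Qdiff j j' : j != j' -> \sum_b source_shift 0 (e j) b * source_shift 0 (e j') b / s ^+ 2 = 0.
  move=> jj'; apply: big1 => -[i|q] _ /=; first by rewrite mul0r mul0r.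
  have [cj|/esupp ->] := boolP (in_cell (val j) (design_point x q.2));
    last by rewrite mul0r mul0r.
  have [cj'|/esupp ->] := boolP (in_cell (val j') (design_point x q.2));
    last by rewrite mulr0 mul0r.
  by move: jj'; rewrite -val_eqE /= (in_cell_inj cj cj') eqxx.
have Qsame j : \sum_b source_shift 0 (e j) b * source_shift 0 (e j) b / s ^+ 2 <= E.
  rewrite big_sumType /= big1 ?add0r; last by move=> i _; rewrite mul0r mul0r.
  pose w : R := (A * D) ^+ 2 / s ^+ 2.
  have w0 : 0 <= w by rewrite divr_ge0 ?sqr_ge0.
  apply: (@le_trans _ _ (\sum_(q : obs_index n p) (in_cell (val j) (design_point x q.2))%:R * w)).
    apply: ler_sum => q _.
    have [cj|/esupp ->] := boolP (in_cell _ _); last by rewrite !mul0r.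
    rewrite mul1r /w ler_pM2r ?invr_gt0 ?exprn_even_gt0 //.
    rewrite -expr2 -real_normK ?num_real // ler_pXn2r ?nnegrE //.
      by rewrite (le_trans (bs_bound H _ _ _ h0)) // ger0_norm.
    by rewrite mulr_ge0 // ltW // (bs_D H).
  rewrite -(pair_bigA _ (fun (i : 'I_n) (v : grid p) =>
    (in_cell (val j) (design_point x v))%:R * w)) /=.
  rewrite sumr_const card_ord -mulr_suml -natr_sum.
  have -> : (\sum_v (in_cell (val j) (design_point x v) : nat) = cell_count x (val j))%N.
    by rewrite /cell_count -sum1dep_card [RHS]big_mkcond /=; apply: eq_bigr => v _; case: ifP.
  have cw : (cell_count x (val j))%:R * m%:R ^+ d <= 2 * (pprod p)%:R :> R.
    by rewrite -natrX -!natrM ler_nat; exact: (valP j).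
  rewrite /E ler_pdivlMr // -mulr_natr.
  rewrite (_ : _ * m%:R ^+ d = (w * n%:R) * ((cell_count x (val j))%:R * m%:R ^+ d)); last by ring.
  apply: (le_trans (ler_wpM2l _ cw)); first by rewrite mulr_ge0.
  by rewrite /w le_eqVlt; apply/orP; left; apply/eqP; ring.
have := @minimax_ge R d al be L CZ s V 0 n p x k rate
  (A * h `^ (- (msize k)%:R) * kap) J (fun=> 0) (fun=> 0) e (fun j => F A h (a j)) t.
apply => //.
- by rewrite expr0n /= mulr0 ltW.
- exact: holder_ray0 H.
- by rewrite !mulr_ge0 ?powR_ge0 ?(ltW (bs_kap H)).
- exact: holder_class0 H L0.
- exact: bs_mderiv0 H.
- by move=> j; apply: (holder_class_bump _ H) => //; rewrite ger0_norm.
- by move=> j q; rewrite mul0r add0r.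
- move=> j; rewrite (bs_mderiv H) //; last by move=> l; rewrite mxE.
  by rewrite ger0_norm.
- have J0' : 0 < #|J|%:R :> R by rewrite ltr0n.
  have row j : \sum_j' expR (\sum_b source_shift 0 (e j) b *
      source_shift 0 (e j') b / s ^+ 2) <= #|J|%:R + expR E.
    rewrite (bigD1 j) //= addrC; apply: lerD; last by rewrite ler_expR.
    apply: (@le_trans _ _ (\sum_(j' : J | j' != j) 1)).
      by apply: ler_sum => j' j'j; rewrite Qdiff ?expR0 // eq_sym.
    by rewrite sumr_const ler_nat max_card.
  apply: (@le_trans _ _ (\sum_(j : J) (#|J|%:R + expR E))); first exact: ler_sum.
  rewrite sumr_const -mulr_natr; move: HE HJ J0'; rewrite expr2; nra.
Qed.

(** * Rates *)

Lemma pmin_le (d : nat) (p : 'I_d -> nat) (k : 'I_d) : (pmin p <= p k)%N.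
Proof.
rewrite /pmin; elim: (index_enum _) (mem_index_enum k) => [//|l r IH].
rewrite inE big_cons geq_min => /orP[/eqP ->|/IH ->]; last by rewrite orbT.
by rewrite leqnn.
Qed.

Lemma limn_einf_ge (R : realType) (u : nat -> \bar R) (c : \bar R) :
  (\forall n \near \oo, (c <= u n)%E) -> (c <= limn_einf u)%E.
Proof.
move=> [N _ HN]; rewrite limn_einf_lim; apply: lime_ge; first exact: is_cvg_einfs.
exists N => // m /= Nm; apply: le_ereal_inf_tmp => _ [n /= mn <-].
by apply: HN; exact: leq_trans mn.
Qed.

Lemma ln_le_sub1 (R : realType) (z : R) : 0 < z -> ln z <= z - 1.
Proof.
move=> z0; have z1 : -1 < z - 1 by lra.
by have := le_ln1Dx z1; rewrite [1 + _]addrC subrK.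
Qed.

(** The slope [1 / 4] leaves room to absorb [ln y] into [y / 2]. *)
Lemma ln_le_affine (R : realType) (y : R) : 0 < y -> ln y <= y / 4 + ln 4.
Proof.
move=> y0; have -> : ln y = ln (y / 4) + ln 4.
  by rewrite -lnM ?posrE ?divr_gt0 // divfK.
rewrite lerD2r; apply: (le_trans (ln_le_sub1 _)); first by rewrite divr_gt0.
by rewrite gerBl.
Qed.

(** The number [m] of cells per direction is the inverse of the rate [b],
    rounded up, so [b / 2 <= 1 / m <= b]. The information is then at most
    [K ln N], while [m ^ d] is at least [exp (rho (ln N - ln (ln N)))] with
    [rho = d / (2 al + d)]; for [K <= rho / 2] the latter wins. *)
Lemma rate_bandwidth (R : realType) (d : nat) (al : R) : (0 < d)%N -> 0 < al ->
  exists Y0 : R, forall N K : R, 0 < N -> Y0 <= ln N ->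
    K <= d%:R / (2 * al + d%:R) / 2 -> 0 <= K ->
    exists m : nat,
      [/\ (0 < m)%N, 0 < (ln N / N) `^ (2 * al + d%:R)^-1,
        (ln N / N) `^ (2 * al + d%:R)^-1 / 2 <= m%:R^-1
      & expR (K * (N * m%:R^-1 `^ (2 * al + d%:R))) <= m%:R ^+ d / 8].
Proof.
move=> d0 al0; set ga := 2 * al + d%:R; set rho := d%:R / ga.
have d0' : 0 < d%:R :> R by rewrite ltr0n.
have ga0 : 0 < ga by rewrite addr_gt0 // mulr_gt0.
have rho0 : 0 < rho by rewrite divr_gt0.
(* the first bound makes ln N positive, the second makes
   rho (y - ln y) - ln 8 at least rho y / 2 *)
pose Y0 : R := Num.max 1 (4 / rho * (ln 8 + rho * ln 4)).
exists Y0 => N K N0; rewrite ge_max => /andP[y1 yY] HK K0.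
set y := ln N in y1 yY *; set b := (y / N) `^ ga^-1.
have y0 : 0 < y by exact: lt_le_trans y1.
have yN0 : 0 < y / N by rewrite divr_gt0.
have b0 : 0 < b by rewrite powR_gt0.
have yN : y <= N.
  by apply: (le_trans (ln_le_sub1 N0)); rewrite gerBl.
have b1 : b <= 1.
  have -> : 1 = 1 `^ ga^-1 :> R by rewrite powR1.
  apply: ge0_ler_powR; rewrite ?nnegrE ?invr_ge0 ?(ltW ga0) ?(ltW yN0) //.
  by rewrite ler_pdivrMr // mul1r.
have bV1 : 1 <= b^-1 by rewrite invf_ge1.
have bga : b `^ ga = y / N.
  by rewrite /b -powRrM mulVf ?gt_eqF // powRr1 // ltW.
pose m := (Num.truncn b^-1).+1.
have /andP[tm1 tm2] := truncn_itv (ltW (lt_le_trans ltr01 bV1)).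
have m0 : 0 < m%:R :> R by rewrite ltr0n.
exists m; split=> //.
  rewrite ler_pdivrMr // mulrC -ler_pdivrMr ?invr_gt0 // invrK.
  have -> : b * m%:R = m%:R / b^-1 by rewrite invrK mulrC.
  by rewrite ler_pdivrMr ?invr_gt0 // /m -natr1; lra.
have mb : m%:R^-1 <= b.
  by rewrite -[leRHS]invrK lef_pV2 ?posrE ?invr_gt0 // ltW.
have e1 : N * m%:R^-1 `^ ga <= y.
  rewrite mulrC -ler_pdivlMr // -bga.
  by apply: ge0_ler_powR; rewrite ?nnegrE ?invr_ge0 ?(ltW ga0) ?(ltW b0).
have e2 : expR (rho * (y - ln y)) <= m%:R ^+ d.
  have -> : expR (rho * (y - ln y)) = b^-1 ^+ d.
    rewrite exprVn -powR_mulrn ?(ltW b0) // /b -powRrM -powRN /powR gt_eqF //.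
    congr expR; rewrite ln_div ?posrE // -/y /rho; ring.
  by apply: lerXn2r; rewrite ?nnegrE ?invr_ge0 ?(ltW b0) // ltW.
apply: (@le_trans _ _ (expR (rho * (y - ln y)) / 8)); last first.
  by rewrite ler_pM2r // invr_gt0.
rewrite -[X in _ <= _ / X](@lnK R 8) ?posrE // -expRN -expRD ler_expR.
apply: (le_trans (ler_wpM2l K0 e1)).
apply: (le_trans (ler_wpM2r (ltW y0) HK)).
have := ln_le_affine y0; move: yY.
rewrite mulrAC ler_pdivrMr // mulrC.
move: rho0; clear; move: (ln 8) (ln 4) (ln y) => l8 l4 ly; move: rho => rho; nra.
Qed.

Section minimax_rates.
Context {R : realType} {d : nat} {al be L CZ s0 : R} {s : 'I_d -> nat}
  {F : R -> R -> ('I_d -> R) -> 'rV[R]_d -> R} {C D kap : R} {tau : 'I_d -> R}.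
Hypotheses (d0 : (0 < d)%N) (al0 : 0 < al) (be0 : 0 < be) (L0 : 0 < L)
  (CZ0 : 0 < CZ) (s00 : 0 < s0) (hs : (msize s <= strict_floor al)%N).
Hypothesis H : @bump_system R d al be s F C D kap tau.

Lemma discretisation_bound : exists2 c : R, 0 < c &
  forall (n : nat) (p : 'I_d -> nat) (x : forall k : 'I_d, 'I_(p k) -> R),
    (0 < pmin p)%N ->
    (c%:E <= minimax_risk al be L CZ s0 n x s
       ((pmin p)%:R `^ (al - (msize s)%:R)))%E.
Proof.
have e0 : 0 <= al - (msize s)%:R.
  by rewrite subr_ge0 ltW // (le_lt_trans _ (strict_floor_lt al0)) // ler_nat.
exists (L / C * kap * 2^-1 `^ (al - (msize s)%:R) / 8).
  by rewrite !mulr_gt0 ?invr_gt0 ?powR_gt0 ?(bs_C H) ?(bs_kap H).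
move=> n p x q0.
have s0' : s0 != 0 by rewrite gt_eqF.
apply: le_trans (between_points_bound n x d0 H L0 CZ0 s0' (powR_ge0 _ _)).
rewrite lee_fin ler_pM2r ?invr_gt0 // mulrCA -powRM ?invr_ge0 //.
rewrite ler_wpM2l //.
  by rewrite !mulr_ge0 ?invr_ge0 ?(ltW L0) ?(ltW (bs_C H)) ?(ltW (bs_kap H)).
apply: ge0_ler_powR; rewrite ?nnegrE ?divr_ge0 ?invr_ge0 //.
rewrite ler_pdivlMr ?ltr0n // mulrC ler_pdivrMr // -natr1.
have : 1 <= (pmin p)%:R :> R by rewrite ler1n.
lra.
Qed.

(** A height [A] of the bump [g] that keeps both the process and the mean in
    their classes for all later choices of the width. *)
Lemma noise_level_exists : exists A V G : R, [/\ 0 < A,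
  (\int[normal_prob 0 s0]_z (z ^+ 2)%:E <= V%:E)%E, V * G ^+ 2 <= CZ,
  A * C <= G & s0 / 4 * A * C <= L].
Proof.
have [|V V0 HV] := @normal_second_moment R s0; first by rewrite gt_eqF.
have C0 := bs_C H.
(* V bounds the second moment of the Gaussian factor of g *)
pose G := Num.sqrt (CZ / V).
have G0 : 0 < G by rewrite sqrtr_gt0 divr_gt0.
exists (Num.min (G / C) (4 * L / (s0 * C))), V, G; split=> //.
- by rewrite lt_min !divr_gt0 ?mulr_gt0.
- by rewrite sqr_sqrtr ?divr_ge0 ?(ltW CZ0) ?(ltW V0) // mulrC divfK ?gt_eqF.
- by rewrite -ler_pdivlMr // ge_min lexx.
- rewrite mulrAC mulrC -ler_pdivlMr ?mulr_gt0 ?divr_gt0 // ge_min; apply/orP; right.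
  rewrite le_eqVlt; apply/orP; left; apply/eqP.
  by rewrite !invfM invrK; ring.
Qed.

Lemma parametric_bound : exists2 c : R, 0 < c &
  forall (n : nat) (p : 'I_d -> nat) (x : forall k : 'I_d, 'I_(p k) -> R),
    (0 < n)%N ->
    (c%:E <= minimax_risk al be L CZ s0 n x s (n%:R `^ (- 2^-1))^-1)%E.
Proof.
have [A [V [G [A0 HV VG AG AL]]]] := noise_level_exists.
exists (s0 / 4 * A * kap / 8).
  by rewrite !mulr_gt0 ?invr_gt0 ?(bs_kap H).
move=> n p x n0; set w : R := n%:R `^ (- 2^-1).
have w0 : 0 < w by rewrite powR_gt0 // ltr0n.
have w1 : w <= 1.
  by rewrite -(powRr0 n%:R) /w; apply: ler_powR; rewrite ?ler1n // oppr_le0 invr_ge0.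
have h01 : 0 < (1 : R) <= 1 by rewrite ltr01 lexx.
have w0' : 0 <= w^-1 by rewrite invr_ge0 ltW.
have := @mean_shift_bound R d al be L CZ s0 V G s F C D kap tau n p x w^-1 A 1
  H L0 s00 HV VG w0' n0 h01 (ltW A0).
rewrite !powR1 /= !mulr1 -/w => /(_ AG) B; apply: le_trans (B _).
  rewrite lee_fin le_eqVlt; apply/orP; left; apply/eqP.
  transitivity ((w^-1 * w) * (s0 / 4 * A * kap / 8)); last by ring.
  by rewrite mulVf ?gt_eqF // mul1r.
apply: le_trans AL; rewrite ler_pM2r ?(bs_C H) // ler_pM2r //.
by rewrite ler_piMr // divr_ge0 // ltW.
Qed.

(** The width [h] solves [h ^ (al - b1) = n ^ (- 1/2)]; with this choice the
    powers of [n] and of [h] cancel in the Hoelder norm of the mean and in the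
    final bound. *)
Lemma rough_process_bound (b1 : R) : be < b1 -> b1 < al -> exists2 c : R, 0 < c &
  forall (n : nat) (p : 'I_d -> nat) (x : forall k : 'I_d, 'I_(p k) -> R),
    (0 < n)%N ->
    (c%:E <= minimax_risk al be L CZ s0 n x s
      (n%:R `^ ((al - (msize s)%:R) / (2 * (al - b1)))))%E.
Proof.
move=> bb1 b1a.
have [A [V [G [A0 HV VG AG AL]]]] := noise_level_exists.
exists (s0 / 4 * A * kap / 8).
  by rewrite !mulr_gt0 ?invr_gt0 ?(bs_kap H).
move=> n p x n0; pose w : R := n%:R `^ (- 2^-1).
have n0' : 0 < n%:R :> R by rewrite ltr0n.
have ab0 : 0 < al - b1 by rewrite subr_gt0.
pose h : R := n%:R `^ (- (2 * (al - b1))^-1).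
have h0 : 0 < h by rewrite powR_gt0.
have h1 : h <= 1.
  rewrite -(powRr0 n%:R) /h; apply: ler_powR; rewrite ?ler1n //.
  by rewrite oppr_le0 invr_ge0 mulr_ge0 // ltW.
have h01 : 0 < h <= 1 by rewrite h0.
have hD u v : h `^ u * h `^ v = h `^ (u + v).
  by rewrite powRD // (gt_eqF h0) implybT.
have wh : w = h `^ (al - b1).
  by rewrite /w /h -powRrM; congr (_ `^ _); rewrite invfM mulNr divfK // gt_eqF.
have rh : n%:R `^ ((al - (msize s)%:R) / (2 * (al - b1))) = h `^ (- (al - (msize s)%:R)).
  by rewrite /h -powRrM mulrNN mulrC.
have Ah0 : 0 <= A * h `^ b1 by rewrite mulr_ge0 ?powR_ge0 // ltW.
have := @mean_shift_bound R d al be L CZ s0 V G s F C D kap tau n p x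
  (n%:R `^ ((al - (msize s)%:R) / (2 * (al - b1)))) (A * h `^ b1) h
  H L0 s00 HV VG (powR_ge0 _ _) n0 h01 Ah0.
rewrite -/w => B; apply: (le_trans _ (B _ _)); clear B.
- rewrite lee_fin rh wh le_eqVlt; apply/orP; left; apply/eqP.
  transitivity ((h `^ (- (al - (msize s)%:R)) * h `^ (al - b1) * h `^ b1 *
    h `^ (- (msize s)%:R)) * (s0 / 4 * A * kap / 8)); last by ring.
  rewrite !hD (_ : _ + _ = 0) ?powRr0 ?mul1r //; ring.
- apply: le_trans AG; rewrite ler_pM2r ?(bs_C H) // -mulrA hD ler_piMr ?(ltW A0) //.
  by rewrite -(powRr0 h); apply: ger_powR => //; rewrite subr_ge0 ltW.
- apply: le_trans AL; rewrite wh.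
  rewrite le_eqVlt; apply/orP; left; apply/eqP.
  transitivity ((h `^ (al - b1) * h `^ b1 * h `^ (- al)) * (s0 / 4 * A * C)); first by ring.
  by rewrite !hD (_ : _ + _ = 0) ?powRr0 ?mul1r //; ring.
Qed.

(** The constant [c0] is so small that the mean lies in the Hoelder class and
    that the information per cell is at most half of what the number of cells
    tolerates. *)
Lemma nonparametric_bound : exists c Y0 : R, 0 < c /\
  forall (n : nat) (p : 'I_d -> nat) (x : forall k : 'I_d, 'I_(p k) -> R),
    let N := n%:R * (pprod p)%:R in 0 < N -> Y0 <= ln N ->
    (c%:E <= minimax_risk al be L CZ s0 n x s
      ((ln N / N) `^ ((al - (msize s)%:R) / (2 * al + d%:R)))^-1)%E.
Proof.
have C0 := bs_C H; have D0 := bs_D H; have kap0 := bs_kap H.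
have e0 : 0 <= al - (msize s)%:R.
  by rewrite subr_ge0 ltW // (le_lt_trans _ (strict_floor_lt al0)) // ler_nat.
set ga := 2 * al + d%:R.
have ga0 : 0 < ga by rewrite addr_gt0 ?mulr_gt0 ?ltr0n.
set rho := d%:R / ga.
have rho0 : 0 < rho by rewrite divr_gt0 ?ltr0n.
pose c0 := Num.min (L / C) (s0 / (2 * D) * Num.sqrt rho).
have c00 : 0 < c0 by rewrite lt_min !(divr_gt0, mulr_gt0) ?sqrtr_gt0.
have c0L : c0 * C <= L by rewrite -ler_pdivlMr // ge_min lexx.
(* K ln N bounds the information in one light cell *)
pose K := 2 * (c0 * D) ^+ 2 / s0 ^+ 2.
have K0 : 0 <= K.
  by apply: divr_ge0; [apply: mulr_ge0 => //|]; exact: sqr_ge0.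
have HK : K <= rho / 2.
  have cD : c0 * D <= s0 * Num.sqrt rho / 2.
    rewrite -ler_pdivlMr // ge_min; apply/orP; right.
    by rewrite le_eqVlt; apply/orP; left; apply/eqP; rewrite invfM; ring.
  have cD2 : (c0 * D) ^+ 2 <= (s0 * Num.sqrt rho / 2) ^+ 2.
    rewrite ler_pXn2r ?nnegrE ?mulr_ge0 ?sqrtr_ge0 ?invr_ge0 ?(ltW c00) ?(ltW D0) ?(ltW s00) //.
  have E : (s0 * Num.sqrt rho / 2) ^+ 2 = s0 ^+ 2 * rho / 4.
    by rewrite !exprMn sqr_sqrtr ?(ltW rho0) // exprVn -natrX.
  rewrite /K ler_pdivrMr ?exprn_gt0 //; move: cD2; rewrite E; lra.
have [Y0 HY] := rate_bandwidth d0 al0.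
exists (c0 * kap * 2^-1 `^ (al - (msize s)%:R) / 8), Y0; split.
  by rewrite !mulr_gt0 ?invr_gt0 ?powR_gt0.
move=> n p x N N0 YN.
have [m [m0 b0 bm Hm]] := HY N K N0 YN HK K0.
move: b0 bm Hm; rewrite -/ga; set b := (ln N / N) `^ ga^-1 => b0 bm Hm.
have m0' : 0 < m%:R :> R by rewrite ltr0n.
set h := m%:R^-1 in bm Hm *.
have h0 : 0 < h by rewrite invr_gt0.
have hD u v : h `^ u * h `^ v = h `^ (u + v).
  by rewrite powRD // (gt_eqF h0) implybT.
have -> : (ln N / N) `^ ((al - (msize s)%:R) / ga) = b `^ (al - (msize s)%:R).
  by rewrite /b -powRrM; congr (_ `^ _); rewrite mulrC.
pose A := c0 * h `^ al.
have A0 : 0 <= A by rewrite mulr_ge0 ?powR_ge0 // ltW.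
have r0 : 0 <= (b `^ (al - (msize s)%:R))^-1 by rewrite invr_ge0 powR_ge0.
have s0' : s0 != 0 by rewrite gt_eqF.
have B := @light_cells_bound R d al be L CZ s0 s F C D kap tau n m p x
  (b `^ (al - (msize s)%:R))^-1 A H L0 CZ0 s0' r0 m0 A0.
apply: (le_trans _ (B _ _)); clear B.
- rewrite lee_fin ler_pM2r ?invr_gt0 // -/h /A.
  rewrite -[c0 * h `^ al * _]mulrA hD.
  rewrite (_ : _ * (c0 * _ * kap) = c0 * kap * (h `^ (al - (msize s)%:R) /
      b `^ (al - (msize s)%:R))); last by ring.
  rewrite ler_pM2l ?mulr_gt0 // ler_pdivlMr; last exact: powR_gt0.
  rewrite -powRM ?invr_ge0 ?(ltW b0) //.
  apply: ge0_ler_powR; rewrite ?nnegrE ?mulr_ge0 ?invr_ge0 ?(ltW b0) ?(ltW h0) //.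
  by rewrite mulrC.
- rewrite -/h /A -[c0 * h `^ al * _]mulrA hD subrr powRr0 mulr1.
  exact: c0L.
- apply: le_trans Hm; rewrite ler_expR le_eqVlt; apply/orP; left; apply/eqP.
  have -> : h `^ ga = h `^ al * h `^ al * (m%:R ^+ d)^-1.
    rewrite /ga mulr2n mulrDl !mul1r -!hD powR_mulrn ?(ltW h0) //.
    by rewrite /h exprVn.
  by rewrite /K /A /N !exprMn; ring.
Qed.

End minimax_rates.

Theorem theorem3 (R : realType) (d : nat) (alpha beta L CZ sigma0 : R)
  (s : 'I_d -> nat) (hd : (0 < d)%N) (halpha : 0 < alpha) (hbeta : 0 < beta)
  (hL : 0 < L) (hCZ : 0 < CZ) (hsigma0 : 0 < sigma0)
  (hs : (msize s <= strict_floor alpha)%N) :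
  [/\
    forall (f : 'I_d -> R -> R) (lo hi : R), design_densities f ->
      0 < lo -> 0 < hi ->
      exists2 c : R, 0 < c &
      forall (p : nat -> 'I_d -> nat)
        (x : forall (n : nat) (k : 'I_d), 'I_(p n k) -> R),
        (fun n => pmin (p n)) @ \oo --> \oo ->
        (\forall n \near \oo, lo * (pmax (p n))%:R <= (pmin (p n))%:R
                              <= hi * (pmax (p n))%:R) ->
        (forall n, is_design (x n)) ->
        (forall n, density_design f (x n)) ->
        (c%:E <= limn_einf (fun n : nat =>
           minimax_risk alpha beta L CZ sigma0 n (x n) s
             ((pmin (p n))%:R `^ (alpha - (msize s)%:R))))%E,
    exists2 c : R, 0 < c &
      forall (p : nat -> 'I_d -> nat)
        (x : forall (n : nat) (k : 'I_d), 'I_(p n k) -> R),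
        (fun n => pmin (p n)) @ \oo --> \oo ->
        (forall n, is_design (x n)) ->
        (c%:E <= limn_einf (fun n : nat =>
           minimax_risk alpha beta L CZ sigma0 n (x n) s
             (a_rate alpha n (p n) s)^-1))%E
  & beta < (msize s)%:R -> forall beta1 : R, beta < beta1 -> beta1 < alpha ->
      exists2 c : R, 0 < c &
      forall (p : nat -> 'I_d -> nat)
        (x : forall (n : nat) (k : 'I_d), 'I_(p n k) -> R),
        (fun n => pmin (p n)) @ \oo --> \oo ->
        (forall n, is_design (x n)) ->
        (c%:E <= limn_einf (fun n : nat =>
           ereal_sup [set minimax_risk alpha beta L CZ sigma0 n (x n) k
               (n%:R `^ ((alpha - (msize s)%:R) / (2 * (alpha - beta1)))) |
             k in [set k : 'I_d -> nat | msize k = msize s]]))%E].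
Proof.
have [F [C [D [kap [tau H]]]]] := bump_system_exists s halpha hbeta.
have pmin_large (p : nat -> 'I_d -> nat) : (fun n => pmin (p n)) @ \oo --> \oo ->
    \forall n \near \oo, (0 < pmin (p n))%N.
  move=> /(_ [set q | (0 < q)%N]); apply.
  by exists 1%N.
have n_large : \forall n \near \oo, (0 < n)%N by exists 1%N.
split.
- move=> f lo hi _ _ _.
  have [c c0 Hc] := discretisation_bound (CZ := CZ) hd halpha hL hCZ hsigma0 hs H.
  exists c => // p x pinf _ _ _; apply: limn_einf_ge.
  by apply: filterS (pmin_large p pinf) => n; exact: Hc.
- have [c1 c10 H1] := parametric_bound hL hCZ hsigma0 H.
  have [c2 [Y0 [c20 H2]]] := nonparametric_bound hd halpha hL hCZ hsigma0 hs H.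
  exists (Num.min c1 c2); first by rewrite lt_min c10.
  move=> p x pinf _; apply: limn_einf_ge.
  have ln_large : \forall n \near \oo, expR Y0 <= n%:R :> R.
    exact: nbhs_infty_ger.
  near=> n.
  have n0 : (0 < n)%N by near: n.
  have q0 : (0 < pmin (p n))%N by near: n; exact: pmin_large.
  have P0 : (0 < pprod (p n))%N.
    by rewrite prodn_gt0 // => k; exact: leq_trans (pmin_le (p n) k).
  rewrite /a_rate; set b := _ `^ _; set w := _ `^ _.
  (* the maximum of the two rates is one of them *)
  have [bw|wb] := leP b w.
    apply: le_trans (H1 n (p n) (x n) n0).
    by rewrite lee_fin ge_min lexx.
  apply: le_trans (H2 n (p n) (x n) _ _); first by rewrite lee_fin ge_min lexx orbT.
    by rewrite mulr_gt0 ?ltr0n.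
  rewrite -[Y0]expRK ler_ln ?posrE ?expR_gt0 ?mulr_gt0 ?ltr0n //.
  apply: (@le_trans _ _ n%:R); first by near: n.
  by rewrite ler_peMr // ler1n.
- move=> _ b1 hb1 b1a.
  have [c c0 Hc] := rough_process_bound hL hCZ hsigma0 H hb1 b1a.
  exists c => // p x pinf _; apply: limn_einf_ge.
  apply: filterS n_large => n n0; apply: le_trans (Hc n (p n) (x n) n0) _.
  by apply: ereal_sup_ubound; exists s.
Unshelve. all: by end_near. Qed.
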